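(* Let $w$ be any quasi-concave function on $[0,1]$ with $w(1)=1$, and let $\mathcal R_1$ be the closed linear span of the Rademacher functions $\{r_n\}_{n=1}^\infty$ in the Morrey space $M_{1,w}$. Then $\mathcal R_1$ is not complemented in $M_{1,w}$.
   Context: A function $w:[0,1]\to[0,\infty)$ is quasi-concave if $w(0)=0$, $w$ is non-decreasing, and $w(t)/t$ is non-increasing on $(0,1]$. The Morrey space $M_{1,w}$ is the Banach space of all (a.e. classes of) measurable $f:[0,1]\to\mathbb R$ with $$\|f\|_{M_{1,w}}=\sup_I \frac{w(|I|)}{|I|}\int_I|f(t)|\,dt<\infty,$$ the supremum being over all (non-degenerate) intervals $I\subset[0,1]$, where $|I|$ is the Lebesgue measure of $I$. The Rademacher functions are $r_k(t)=\mathrm{sign}(\sin 2^k\pi t)$, $k\in\mathbb N=\{1,2,\dots\}$, $t\in[0,1]$. A closed subspace is complemented if it is the range of a bounded linear projection of the whole space. *)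

(* Defs.v *)
From HB Require Import structures.
From mathcomp Require Import all_boot all_order all_algebra.
From mathcomp Require Import all_classical all_reals all_analysis.
From mathcomp Require Import measurable_realfun ring_quotient.
From mathcomp Require Import lra.

Set Implicit Arguments.
Unset Strict Implicit.
Unset Printing Implicit Defensive.
Import Order.TTheory GRing.Theory Num.Theory.
Import numFieldNormedType.Exports.

Local Open Scope classical_set_scope.
Local Open Scope ring_scope.

(* A weight on [0, 1] is a total function R -> R of which only the values on
   [0, 1] are constrained, and used. *)
Record quasi_concave (R : realType) (w : R -> R) : Prop := QuasiConcave {
  quasi_concave0 : w 0 = 0 ;
  quasi_concave_ge0 : forall t, 0 <= t <= 1 -> 0 <= w t ;
  quasi_concave_nondecreasing :
    forall s t, 0 <= s -> s <= t -> t <= 1 -> w s <= w t ;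
  quasi_concave_nonincreasing :
    forall s t, 0 < s -> s <= t -> t <= 1 -> w t / t <= w s / s }.

Section morrey_norm.
Context {R : realType}.
Implicit Types (w f g : R -> R) (I : interval R).
Local Notation mu := (@lebesgue_measure R).

Definition unit_itv : set R := `[0, 1].

(* intervals of any type (open, closed, half-open); positive length excludes
   exactly the empty ones and the singletons *)
Definition nondegenerate_subitv : set (interval R) :=
  [set I | [set` I] `<=` unit_itv /\ (0 < mu [set` I])%E].

Definition itv_length I : R := fine (mu [set` I]).

Definition morrey_norm w f : \bar R :=
  ereal_sup [set ((w (itv_length I) / itv_length I)%:E
                  * \int[mu]_(x in [set` I]) `|f x|%:E)%E
            | I in nondegenerate_subitv].

Lemma measurable_unit_itv : measurable unit_itv.
Proof. exact: measurable_itv. Qed.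

Lemma lebesgue_measure_unit_itv : mu unit_itv = 1%E.
Proof. by rewrite lebesgue_measure_itv/= lte_fin ltr01 oppr0 adde0. Qed.

Lemma itv_lengthK I : nondegenerate_subitv I ->
  (itv_length I)%:E = mu [set` I].
Proof.
move=> [I01 I0]; rewrite fineK// ge0_fin_numE//.
apply: (@le_lt_trans _ _ (mu unit_itv)).
  by apply: le_measure => //; rewrite inE; exact: measurable_itv.
by rewrite lebesgue_measure_unit_itv ltry.
Qed.

Lemma itv_length_gt0 I : nondegenerate_subitv I -> 0 < itv_length I.
Proof. by move=> HI; rewrite -lte_fin itv_lengthK//; case: HI. Qed.

Lemma itv_length_le1 I : nondegenerate_subitv I -> itv_length I <= 1.
Proof.
move=> HI; rewrite -lee_fin itv_lengthK// -lebesgue_measure_unit_itv.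
case: HI => I01 _.
by apply: le_measure => //; rewrite inE; exact: measurable_itv.
Qed.

Lemma nondegenerate_unit_itv : nondegenerate_subitv `[0, 1].
Proof. by split => //; rewrite lebesgue_measure_unit_itv. Qed.

Lemma measurable_absE I f : nondegenerate_subitv I ->
  measurable_fun unit_itv f ->
  measurable_fun [set` I] (EFin \o (@Num.norm R R \o f)).
Proof.
move=> [I01 _] mf; apply/measurable_EFinP.
apply: (measurableT_comp (@normr_measurable R setT)).
by apply: measurable_funS mf => //; exact: measurable_unit_itv.
Qed.

Lemma morrey_coef_ge0 w I : quasi_concave w -> nondegenerate_subitv I ->
  0 <= w (itv_length I) / itv_length I.
Proof.
move=> hw HI; apply: divr_ge0; last exact/ltW/itv_length_gt0.
by apply: (quasi_concave_ge0 hw); rewrite itv_length_le1// ltW// itv_length_gt0.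
Qed.

Lemma morrey_norm_ge0 w f : quasi_concave w -> (0 <= morrey_norm w f)%E.
Proof.
move=> hw; apply: le_ereal_sup_tmp.
eexists; first by exists `[0, 1]; [exact: nondegenerate_unit_itv|reflexivity].
apply: mule_ge0; last by apply: integral_ge0 => x _; rewrite lee_fin.
by rewrite lee_fin morrey_coef_ge0//; exact: nondegenerate_unit_itv.
Qed.

Lemma morrey_normD w f g : quasi_concave w ->
  measurable_fun unit_itv f -> measurable_fun unit_itv g ->
  (morrey_norm w (f + g)%R <= morrey_norm w f + morrey_norm w g)%E.
Proof.
move=> hw mf mg; apply: ge_ereal_sup => _ [I HI <-].
have c0 := morrey_coef_ge0 hw HI.
apply: (@le_trans _ _ ((w (itv_length I) / itv_length I)%:E *
   (\int[mu]_(x in [set` I]) `|f x|%:E + \int[mu]_(x in [set` I]) `|g x|%:E))%E).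
  apply: lee_wpmul2l; first by rewrite lee_fin.
  have mI : measurable [set` I] by exact: measurable_itv.
  rewrite -ge0_integralD//;
    [|exact: (measurable_absE HI mf)|exact: (measurable_absE HI mg)].
  apply: ge0_le_integral => //.
  - exact: (measurable_absE HI (measurable_funD mf mg)).
  - by apply: emeasurable_funD;
      [exact: (measurable_absE HI mf)|exact: (measurable_absE HI mg)].
  - by move=> x _; rewrite -EFinD lee_fin; exact: ler_normD.
rewrite ge0_muleDr; try by apply: integral_ge0 => x _; rewrite lee_fin.
by apply: leeD; apply: ereal_sup_ubound; exists I.
Qed.

Lemma morrey_normZ_le w f (k : R) : quasi_concave w ->
  measurable_fun unit_itv f ->
  (morrey_norm w (k *: (f : R -> R^o))%R <= `|k|%:E * morrey_norm w f)%E.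
Proof.
move=> hw mf; apply: ge_ereal_sup => _ [I HI <-].
have mI : measurable [set` I] by exact: measurable_itv.
under eq_integral do rewrite /= normrM EFinM.
rewrite ge0_integralZl//; last exact: (measurable_absE HI mf).
rewrite muleCA; apply: lee_wpmul2l; first by rewrite lee_fin.
by apply: ereal_sup_ubound; exists I.
Qed.

Lemma morrey_normZ w f (k : R) : quasi_concave w ->
  measurable_fun unit_itv f ->
  (morrey_norm w (k *: (f : R -> R^o))%R = `|k|%:E * morrey_norm w f)%E.
Proof.
move=> hw mf; apply/eqP; rewrite eq_le morrey_normZ_le//=.
have [->|k0] := eqVneq k 0; first by rewrite normr0 mul0e morrey_norm_ge0.
have mkf : measurable_fun unit_itv (k *: (f : R -> R^o)).
  by apply: measurable_funM.
have := @morrey_normZ_le w _ k^-1 hw mkf.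
rewrite scalerA mulVf// scale1r => h.
have nk0 : 0 < `|k| by rewrite normr_gt0.
apply: le_trans (lee_wpmul2l _ h) _; first by rewrite lee_fin.
by rewrite muleA -EFinM normfV divff ?gt_eqF// mul1e.
Qed.

Lemma eq_ae_morrey_norm w f g :
  measurable_fun unit_itv f -> measurable_fun unit_itv g ->
  ae_eq mu unit_itv f g ->
  morrey_norm w f = morrey_norm w g.
Proof.
move=> mf mg fg; rewrite /morrey_norm; congr ereal_sup.
apply: eq_imagel => I HI; congr mule.
apply: ge0_ae_eq_integral => //.
- exact: (measurable_absE HI mf).
- exact: (measurable_absE HI mg).
case: HI fg => I01 _ [N [mN N0 fgN]]; exists N; split => // x fgx.
by apply: fgN => h; apply: fgx => /I01/h ->.
Qed.

Lemma morrey_norm_eq0 w f : w 1 = 1 ->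
  measurable_fun unit_itv f -> morrey_norm w f = 0%E ->
  ae_eq mu unit_itv f (cst 0).
Proof.
move=> w1 mf f0.
have : (\int[mu]_(x in unit_itv) `|(EFin \o f) x| = 0)%E.
  apply/eqP; rewrite eq_le integral_ge0// andbT -f0.
  apply: ereal_sup_ubound; exists `[0, 1]; first exact: nondegenerate_unit_itv.
  rewrite /itv_length lebesgue_measure_unit_itv/= w1 divr1 mul1e.
  by apply: eq_integral.
move/ae_eq_integral_abs.
move=> /(_ measurable_unit_itv) h.
have {}h := h (proj2 (measurable_EFinP _ _) mf).
case: h => N [mN N0 fN]; exists N; split => // x fx.
by apply: fN => h; apply: fx => /h [].
Qed.

End morrey_norm.

Section morrey_space.
Context {R : realType} {w : R -> R}.
Variables (hw : quasi_concave w) (w1 : w 1 = 1).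
Local Notation mu := (@lebesgue_measure R).

(* Only the values on [0, 1] of f : R -> R matter: measurability and the norm
   look at f on [0, 1], and the quotient below identifies functions that agree
   a.e. on [0, 1].  Measurability is Borel measurability, which yields the same
   a.e. classes as Lebesgue measurability.
   The proof of quasi-concavity is a parameter of the predicate because closure
   under addition and scaling needs w >= 0. *)
Definition morrey_pred of quasi_concave w : {pred R -> R^o} :=
  [pred f | `[< measurable_fun unit_itv (f : R -> R)
                /\ (morrey_norm w f < +oo)%E >]].

Lemma morrey_submod_closed : submod_closed (morrey_pred hw).
Proof.
split=> [|k f g]; rewrite !inE.
  have m0 : measurable_fun unit_itv (0 : R -> R) by exact: measurable_cst.
  split => //.
  have := @morrey_normZ_le R w 0 0 hw m0.
  by rewrite scale0r normr0 mul0e => /le_lt_trans; apply; rewrite ltry.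
move=> [mf ff] [mg fg].
have mkf : measurable_fun unit_itv (k *: f : R -> R) by exact: measurable_funM.
split; first exact: measurable_funD.
apply: (le_lt_trans (morrey_normD hw mkf mg)); apply: lte_add_pinfty => //.
apply: (le_lt_trans (morrey_normZ_le _ hw mf)).
by rewrite lte_mul_pinfty// lee_fin.
Qed.

HB.instance Definition _ :=
  GRing.isSubmodClosed.Build R (R -> R^o) (morrey_pred hw) morrey_submod_closed.

Record morrey_fun : Type := MorreyFun {
  morrey_fun_val :> R -> R^o ;
  morrey_funP : morrey_fun_val \in morrey_pred hw }.

HB.instance Definition _ := [isSub for morrey_fun_val].
HB.instance Definition _ := [Choice of morrey_fun by <:].
HB.instance Definition _ := [SubChoice_isSubLmodule of morrey_fun by <:].

Lemma morrey_fun_measurable (f : morrey_fun) :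
  measurable_fun unit_itv (f : R -> R).
Proof. by have /asboolP[] := morrey_funP f. Qed.

Lemma morrey_fun_lty (f : morrey_fun) : (morrey_norm w f < +oo)%E.
Proof. by have /asboolP[] := morrey_funP f. Qed.

Lemma morrey_fun_fin_num (f : morrey_fun) : morrey_norm w f \is a fin_num.
Proof. by rewrite ge0_fin_numE ?morrey_fun_lty// morrey_norm_ge0. Qed.

Definition morrey_null : {pred morrey_fun} :=
  [pred f : morrey_fun | `[< ae_eq mu unit_itv (f : R -> R) (cst 0) >]].

Lemma morrey_null_submod_closed : submod_closed morrey_null.
Proof.
split=> [|k f g]; rewrite !inE; first exact: ae_eq_refl.
move=> [A [mA A0 fA]] [B [mB B0 gB]].
exists (A `|` B); split; [exact: measurableU|by rewrite measureU0|].
move=> x kfg; have [Ax|Ax] := pselect (A x); [by left|right].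
apply: gB => g0; apply: kfg => x01.
have f0 : (f : R -> R) x = 0.
  by apply: contrapT => f0; apply: Ax; apply: fA => /(_ x01).
rewrite -[LHS]/(k *: (f : R -> R^o) x + (g : R -> R^o) x).
by rewrite f0 g0// scaler0 addr0.
Qed.

HB.instance Definition _ :=
  GRing.isSubmodClosed.Build R morrey_fun morrey_null morrey_null_submod_closed.

(* a.e. classes: f and g are identified when f - g vanishes a.e. on [0, 1]
   (see morrey_classP).  The hypothesis w 1 = 1 makes the norm separated. *)
Definition morrey of w 1 = 1 : Type := Quotient.quot morrey_null.
Local Notation M := (morrey w1).
HB.instance Definition _ := GRing.Zmodule.on M.
HB.instance Definition _ := EqQuotient.on M.

Local Notation pi := (\pi_(Quotient.quot morrey_null)%qT : morrey_fun -> M).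

Definition morrey_class (f : morrey_fun) : M := pi f.
Definition morrey_repr (x : M) : morrey_fun := repr x.

Lemma morrey_reprK : cancel morrey_repr morrey_class.
Proof. exact: reprK. Qed.

Lemma morrey_classP (f g : morrey_fun) :
  morrey_class f = morrey_class g <-> ae_eq mu unit_itv (f : R -> R) (g : R -> R).
Proof.
have -> : (morrey_class f = morrey_class g) <-> f - g \in morrey_null.
  by rewrite Quotient.idealrBE; split=> [/eqP|/eqP].
rewrite !inE; split=> -[N [mN N0 fgN]]; exists N; split => // x fgx; apply: fgN.
- move=> h; apply: fgx => /h/eqP.
  by rewrite -[X in X == _]/((f : R -> R) x - (g : R -> R) x) subr_eq0 => /eqP.
- move=> h; apply: fgx => /h fgx; apply/eqP.
  by rewrite -[X in X == _]/((f : R -> R) x - (g : R -> R) x) subr_eq0 fgx.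
Qed.

Lemma morrey_classD : {morph morrey_class : f g / f + g}.
Proof. by move=> f g; rewrite /morrey_class /= raddfD. Qed.

Definition morrey_scale (k : R) (x : M) : M := morrey_class (k *: morrey_repr x).

Lemma morrey_classZ k : {morph morrey_class : f / k *: f >-> morrey_scale k f}.
Proof.
move=> f; apply/eqP; rewrite /morrey_scale /morrey_class.
rewrite -Quotient.idealrBE -scalerBr; apply: rpredZ.
by rewrite Quotient.idealrBE; apply/eqP; rewrite reprK.
Qed.

Lemma morrey_scaleA (a b : R) (x : M) :
  morrey_scale a (morrey_scale b x) = morrey_scale (a * b) x.
Proof. by rewrite -(morrey_reprK x) -!morrey_classZ scalerA. Qed.

Lemma morrey_scale1 : left_id 1 morrey_scale.
Proof. by move=> x; rewrite -(morrey_reprK x) -morrey_classZ scale1r. Qed.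

Lemma morrey_scaleDr : right_distributive morrey_scale +%R.
Proof.
move=> a x y; rewrite -(morrey_reprK x) -(morrey_reprK y).
by rewrite -!morrey_classZ -!morrey_classD -morrey_classZ scalerDr.
Qed.

Lemma morrey_scaleDl x : {morph morrey_scale^~ x : a b / a + b}.
Proof.
move=> a b; rewrite -(morrey_reprK x).
by rewrite -!morrey_classZ -morrey_classD scalerDl.
Qed.

HB.instance Definition _ := GRing.Zmodule_isLmodule.Build R M
  morrey_scaleA morrey_scale1 morrey_scaleDr morrey_scaleDl.

Definition morrey_class_norm (x : M) : R := fine (morrey_norm w (morrey_repr x)).

Lemma morrey_class_normE (f : morrey_fun) :
  (morrey_class_norm (morrey_class f))%:E = morrey_norm w f.
Proof.
rewrite fineK ?morrey_fun_fin_num//.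
apply: eq_ae_morrey_norm; try exact: morrey_fun_measurable.
by apply/morrey_classP; exact: morrey_reprK.
Qed.

Lemma morrey_class_normD (x y : M) :
  morrey_class_norm (x + y) <= morrey_class_norm x + morrey_class_norm y.
Proof.
rewrite -(morrey_reprK x) -(morrey_reprK y) -morrey_classD -lee_fin EFinD.
rewrite !morrey_class_normE; apply: morrey_normD => //;
  exact: morrey_fun_measurable.
Qed.

Lemma morrey_class_normZ (k : R) (x : M) :
  morrey_class_norm (k *: x) = `|k| * morrey_class_norm x.
Proof.
rewrite -(morrey_reprK x) -[k *: _]morrey_classZ.
apply: EFin_inj; rewrite EFinM !morrey_class_normE morrey_normZ//.
exact: morrey_fun_measurable.
Qed.

Lemma morrey_class_norm_eq0 (x : M) : morrey_class_norm x = 0 -> x = 0.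
Proof.
rewrite -(morrey_reprK x); move: (morrey_repr x) => f f0.
have nf0 : morrey_norm w f = 0%E by rewrite -morrey_class_normE f0.
have -> : 0 = morrey_class 0 by rewrite /morrey_class raddf0.
apply/morrey_classP.
exact: (morrey_norm_eq0 w1 (morrey_fun_measurable f) nf0).
Qed.

HB.instance Definition _ := Lmodule_isNormed.Build R M
  morrey_class_normD morrey_class_normZ morrey_class_norm_eq0.

Lemma morrey_normE (f : morrey_fun) :
  `|morrey_class f|%:E = morrey_norm w f.
Proof. exact: morrey_class_normE. Qed.

End morrey_space.

Section rademacher.
Context {R : realType}.

Definition rademacher (k : nat) (t : R) : R := Num.sg (sin (2 ^+ k * pi * t)).

Lemma measurable_rademacher k (D : set R) : measurable_fun D (rademacher k).
Proof.
apply: (@measurable_funS _ _ _ _ setT) => //.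
have msg : measurable_fun [set: R] (@Num.sg R).
  apply: nondecreasing_measurable => // x y xy.
  have [x0|x0|x0] := ltrgt0P x; have [y0|y0|y0] := ltrgt0P y;
    rewrite ?(gtr0_sg x0) ?(ltr0_sg x0) ?(gtr0_sg y0) ?(ltr0_sg y0) ?x0 ?y0
      ?sgr0//; lra.
apply: (measurableT_comp msg).
apply: (@measurableT_comp _ _ _ _ _ _ (@sin R)).
  by apply: continuous_measurable_fun; exact: continuous_sin.
by apply: measurable_funM.
Qed.

Lemma rademacher_le1 k t : `|rademacher k t| <= 1.
Proof. by rewrite /rademacher normr_sg; case: eqP => //=. Qed.

Lemma rademacher_in_morrey w (hw : quasi_concave w) k :
  (rademacher k : R -> R^o) \in morrey_pred hw.
Proof.
rewrite inE; split; first exact: measurable_rademacher.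
apply: (@le_lt_trans _ _ (w 1)%:E); last exact: ltry.
apply: ge_ereal_sup => _ [I HI <-].
have mI : measurable [set` I] by exact: measurable_itv.
have l0 := itv_length_gt0 HI.
apply: (@le_trans _ _
    ((w (itv_length I) / itv_length I)%:E * (itv_length I)%:E)%E).
  apply: lee_wpmul2l; first by rewrite lee_fin morrey_coef_ge0.
  rewrite itv_lengthK//.
  rewrite -[leRHS]mul1e -integral_cst//.
  apply: ge0_le_integral => //.
  - by apply: (measurable_absE HI); exact: measurable_rademacher.
  - by move=> x _; rewrite lee_fin rademacher_le1.
rewrite -EFinM divfK ?gt_eqF// lee_fin.
by apply: (quasi_concave_nondecreasing hw); rewrite ?itv_length_le1// ltW.
Qed.

End rademacher.

Definition linear_span (R : pzRingType) (V : lmodType R) (A : set V) : set V :=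
  [set v | exists n (a : 'I_n -> R) (u : 'I_n -> V),
     (forall i, A (u i)) /\ v = \sum_(i < n) a i *: u i].

Definition closed_linear_span (R : realType) (V : normedModType R)
    (A : set V) : set V :=
  closure (linear_span A).

Definition complemented (R : realType) (V : normedModType R) (W : set V) : Prop :=
  exists P : {linear V -> V},
    [/\ exists C : R, forall x, `|P x| <= C * `|x|,
        forall x, P (P x) = P x
      & range P = W].

Definition rademacher_class (R : realType) (w : R -> R)
    (hw : quasi_concave w) (w1 : w 1 = 1) (k : nat) : morrey hw w1 :=
  morrey_class w1 (MorreyFun (rademacher_in_morrey hw k)).

Definition rademacher_subspace (R : realType) (w : R -> R)
    (hw : quasi_concave w) (w1 : w 1 = 1) : set (morrey hw w1) :=
  closed_linear_span [set rademacher_class hw w1 k | k in [set k | (1 <= k)%N]].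
Arguments rademacher_subspace {R w} hw w1 _.

(* Main.v *)
Require Import Defs.
From HB Require Import structures.
From mathcomp Require Import all_boot all_order all_algebra.
From mathcomp Require Import all_classical all_reals all_analysis.
From mathcomp Require Import measurable_realfun.
From mathcomp Require Import lra.

(** Let P be a bounded projection onto the closed span of the Rademacher
    functions r_k, of norm at most C.  Fix indices kappa 0 < kappa 1 < ... and
    put x_i := r_(kappa i) for i < m, c_i h := int h x_i on [0, 1], and, for a
    sign vector eps, F_eps := sum_A a_A prod_(i in A) eps_i x_i, the sum being
    over the subsets A of the index set.  Averaging over all sign vectors kills
    every Walsh function of degree other than one,
      E_eps sum_i eps_i c_i (P F_eps) = sum_i a_{i} c_i (P x_i) = sum_i a_{i},
    because P x_i = x_i.  So, whenever the functional sum_i eps_i c_i has norm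
    at most B on the span and all F_eps have norm at most K, one gets
    sum_i a_{i} <= B C K (projection_trace_bound, projection_multilinear_bound).

    Two families of products feed this inequality, both with m = n ^ 2.  The
    positive Riesz product prod_j (1 + eps_j x_j) has a_{i} = 1.  The imaginary
    part of prod_j (1 + sqrt(-1) eps_j x_j / n) has a_{i} = 1 / n, and its
    absolute value is at most (1 + 1 / n ^ 2) ^ (m / 2) <= e (riesz_le).

    If w tends to 0 at 0, choose kappa so sparse that
    w (2 ^- kappa i) <= 2 ^- i.+1.  Over an interval of length l lying between
    two consecutive scales the first p factors of the positive product are at
    most 2 and the others average to 1, while w l <= 2 ^- p: the Morrey norm is
    at most 3 (sparse_product_integral_le).  Integration against the bounded
    Riesz product shows that sum_i eps_i c_i has norm at most e n on the span
    (signed_coef_riesz_bound).  Hence n ^ 2 <= 3 e n C.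

    Otherwise w >= c > 0 on ]0, 1], the Morrey norm dominates c times the sup
    norm on step functions, and kappa i = i.+1 will do.  The bounded Riesz
    product has Morrey norm at most e, and sum_i eps_i c_i has norm at most
    1 / c on the span, since any sign pattern of r_1, ..., r_N is realised on a
    dyadic interval (signed_coef_sup_bound).  Hence n <= e C / c.

    Both conclusions fail for large n. *)

Set Implicit Arguments.
Unset Strict Implicit.
Unset Printing Implicit Defensive.
Import Order.TTheory GRing.Theory Num.Theory.
Import numFieldNormedType.Exports.

Local Open Scope classical_set_scope.
Local Open Scope ring_scope.

(** * Sign averages and Riesz products *)

Section linear_forms.
Context {R : pzRingType} {V : lmodType R}.

Lemma linear_form_sum (L : V -> R) : linear_for *%R L ->
  forall (I : Type) (r : seq I) (c : I -> R) (x : I -> V),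
  L (\sum_(i <- r) c i *: x i) = \sum_(i <- r) c i * L (x i).
Proof.
move=> linL I r c x.
have L0 : L 0 = 0.
  have := linL 1 0 0; rewrite scale1r addr0 mul1r => /eqP.
  by rewrite -subr_eq0 opprD addNKr oppr_eq0 => /eqP.
elim: r => [|i r IH]; first by rewrite !big_nil.
by rewrite !big_cons linL IH.
Qed.

End linear_forms.

(** Subsets of T encode the vertices of the cube {-1, 1}^T, so that averages
    over sign vectors are sums over a finite type. *)
Definition cube_sign (R : pzRingType) (T : finType) (E : {set T}) (i : T) : R :=
  (-1) ^+ (i \in E).

Section signs.
Context {R : realFieldType} {T : finType}.
Implicit Types (A E : {set T}).

(** Orthogonality of the characters of {-1, 1}^T: the sum factors over the
    coordinates, and the factor of i vanishes as soon as i belongs to exactly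
    one of A and [set i0]. *)
Lemma sum_cube_sign A i0 :
  \sum_(E : {set T}) cube_sign R E i0 * \prod_(i in A) cube_sign R E i =
  if A == [set i0]%SET then 2 ^+ #|T| else 0.
Proof.
pose h i : R := (-1) ^+ ((i \in A) + (i == i0))%N.
have hE E : cube_sign R E i0 * \prod_(i in A) cube_sign R E i =
    \prod_i (if i \in E then h i else 1).
  have -> : cube_sign R E i0 = \prod_(i : T) cube_sign R E i ^+ (i == i0).
    rewrite (bigD1 i0)//= eqxx expr1 big1 ?mulr1// => i /negPf ->.
    by rewrite expr0.
  rewrite [\prod_(i in A) _]big_mkcond -big_split/=.
  apply: eq_bigr => i _; rewrite /cube_sign /h.
  by case: (i \in E); case: (i \in A); case: (i == i0);
    rewrite ?expr0 ?expr1 ?expr1n ?mulr1 ?mul1r ?expr2.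
under eq_bigr do rewrite hE.
transitivity (\prod_i (h i + 1)); first by rewrite bigA_distr.
have [A1|neq] := eqVneq A [set i0]%SET.
  rewrite -prodr_const; apply: eq_bigr => i _.
  rewrite /h A1 inE; case: (i == i0); rewrite ?expr0 /= ?sqrrN ?expr1n; lra.
have [i ih] : exists i, (i \in A) != (i == i0).
  apply/existsP; apply: contraNT neq; rewrite negb_exists => /forallP H.
  by apply/eqP/setP => i; rewrite inE; have := H i; rewrite negbK => /eqP.
rewrite (bigD1 i)//= /h.
by move: ih; case: (i \in A); case: (i == i0) => //= _; rewrite expr1; lra.
Qed.

(** Only the terms of degree one survive the average, and each of them meets
    only its own functional L i. *)
Lemma cube_sign_average (V : lmodType R) (v : {set T} -> V) (a : {set T} -> R)
    (L : T -> V -> R) :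
  (forall i, linear_for *%R (L i)) ->
  \sum_(E : {set T}) \sum_i cube_sign R E i *
     L i (\sum_(A : {set T}) (a A * \prod_(j in A) cube_sign R E j) *: v A) =
  2 ^+ #|T| * \sum_i a [set i]%SET * L i (v [set i]%SET).
Proof.
move=> linL.
rewrite exchange_big/= mulr_sumr; apply: eq_bigr => i _.
transitivity (\sum_(E : {set T}) \sum_(A : {set T})
    (a A * L i (v A)) * (cube_sign R E i * \prod_(j in A) cube_sign R E j)).
  apply: eq_bigr => E _; rewrite (linear_form_sum (linL i)) mulr_sumr.
  by apply: eq_bigr => A _; lra.
rewrite exchange_big/= (bigD1 [set i]%SET)//= -mulr_sumr sum_cube_sign eqxx.
rewrite big1 ?addr0 => [|A /negPf Ai]; first by rewrite mulrC.
by rewrite -mulr_sumr sum_cube_sign Ai mulr0.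
Qed.

End signs.

(** The complex plane over R: its multiplication gives the expansion of the
    Riesz product below, and its modulus the bound. *)
Definition cplane (R : realType) : Type := (R * R)%type.

Section cplane.
Context {R : realType}.

HB.instance Definition _ := GRing.Zmodule.on (cplane R).

Let cplane_mul (y z : cplane R) : cplane R :=
  (y.1 * z.1 - y.2 * z.2, y.1 * z.2 + y.2 * z.1).

Let cplane_mulA : associative cplane_mul.
Proof. by move=> x y z; congr pair => /=; lra. Qed.

Let cplane_mulC : commutative cplane_mul.
Proof. by move=> x y; congr pair => /=; lra. Qed.

Let cplane_mul1 : left_id ((1, 0) : cplane R) cplane_mul.
Proof. by case=> x y; congr pair => /=; lra. Qed.

Let cplane_mulDl : left_distributive cplane_mul +%R.
Proof. by move=> x y z; congr pair => /=; lra. Qed.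

HB.instance Definition _ := GRing.Zmodule_isComPzRing.Build (cplane R)
  cplane_mulA cplane_mulC cplane_mul1 cplane_mulDl.

Definition real_pt (x : R) : cplane R := (x, 0).
Definition imag_pt (y : R) : cplane R := (0, y).

End cplane.

Section riesz.
Context {R : realType} {T : finType}.
Implicit Types (x : T -> R) (s : R).

Lemma prodr1D (S : comPzRingType) (x : T -> S) :
  \prod_i (1 + x i) = \sum_(A : {set T}) \prod_(i in A) x i.
Proof.
under eq_bigr do rewrite addrC.
rewrite bigA_distr; apply: eq_bigr => A _.
by rewrite [RHS]big_mkcond.
Qed.

(** The imaginary part of the product of the 1 + sqrt(-1) s x_i. *)
Definition riesz s x : R := (\prod_i (1 + imag_pt (s * x i))).2.

Definition riesz_coef s (A : {set T}) : R := (imag_pt s ^+ #|A|).2.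

Lemma riesz_coef1 s i : riesz_coef s [set i]%SET = s.
Proof. by rewrite /riesz_coef cards1 expr1. Qed.

Lemma riesz_expansion s x :
  riesz s x = \sum_(A : {set T}) riesz_coef s A * \prod_(i in A) x i.
Proof.
have im_sum (I : finType) (f : I -> cplane R) : (\sum_i f i).2 = \sum_i (f i).2.
  by apply: (big_morph (fun z : cplane R => z.2)).
have real_prod (A : {set T}) :
    \prod_(i in A) real_pt (x i) = real_pt (\prod_(i in A) x i).
  apply: (big_rec2 (fun (z : cplane R) r => z = real_pt r)) => // i z r _ ->.
  by congr pair; rewrite /= ?mulr0 ?mul0r ?addr0 ?subr0.
rewrite /riesz prodr1D im_sum; apply: eq_bigr => A _ /=.
have -> : \prod_(i in A) imag_pt (s * x i) =
    imag_pt s ^+ #|A| * \prod_(i in A) real_pt (x i).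
  rewrite -prodr_const -big_split/=; apply: eq_bigr => i _.
  by congr pair; rewrite /= ?mulr0 ?mul0r ?subr0 ?add0r.
by rewrite real_prod /riesz_coef /= mulr0 add0r.
Qed.

Let sqnorm (z : cplane R) : R := z.1 ^+ 2 + z.2 ^+ 2.

Let sqnormM y z : sqnorm (y * z) = sqnorm y * sqnorm z.
Proof. by case: y z => a b [c d]; rewrite /sqnorm/=; lra. Qed.

(** The squared modulus of the complex product is (1 + s ^ 2) ^+ #|T|, which
    is at most expR (s ^ 2 * #|T|). *)
Lemma riesz_le s x : s ^+ 2 * #|T|%:R <= 1 -> (forall i, x i ^+ 2 = 1) ->
  `|riesz s x| <= expR 1.
Proof.
move=> sT x1; have e1 : 1 <= expR 1 :> R by rewrite ltW// expR_gt1.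
have : riesz s x ^+ 2 <= expR 1.
  apply: (@le_trans _ _ (sqnorm (\prod_i (1 + imag_pt (s * x i))))).
    by rewrite /sqnorm lerDr sqr_ge0.
  rewrite (big_morph sqnorm sqnormM (_ : _ = 1)); last first.
    by rewrite /sqnorm/= expr1n expr0n/= addr0.
  apply: (@le_trans _ _ (\prod_(i : T) expR (s ^+ 2))).
    apply: ler_prod => i _; rewrite /sqnorm/= !add0r addr0.
    by rewrite expr1n exprMn x1 mulr1 expR_ge1Dx addr_ge0// sqr_ge0.
  by rewrite prodr_const -expRM_natr ler_expR.
move=> h; rewrite -(@ler_pXn2r _ 2)// ?nnegrE ?expR_ge0//.
rewrite real_normK ?num_real//; apply: (le_trans h).
by rewrite expr2 ler_peMr// expR_ge0.
Qed.

End riesz.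

(** The average of sum_i eps_i L_i (P x_eps) over all sign vectors eps is the
    trace sum_i a_{i}, whereas each of its terms is at most B (C K). *)
Lemma projection_trace_bound (R : realType) (V : normedModType R) (T : finType)
    (P : {linear V -> V}) (C K B : R) (L : T -> V -> R)
    (v : {set T} -> V) (a : {set T} -> R) :
  0 <= C -> 0 <= B ->
  (forall x, `|P x| <= C * `|x|) ->
  (forall i, linear_for *%R (L i)) ->
  (forall i, L i (P (v [set i]%SET)) = 1) ->
  (forall E x, \sum_i cube_sign R E i * L i (P x) <= B * `|P x|) ->
  (forall E : {set T},
     `|\sum_(A : {set T}) (a A * \prod_(j in A) cube_sign R E j) *: v A|
     <= K) ->
  \sum_i a [set i]%SET <= B * (C * K).
Proof.
move=> C0 B0 PC linL L1 LB aK.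
have linLP i : linear_for *%R (L i \o P).
  by move=> k x y; rewrite /= linearP linL.
have := cube_sign_average v a linLP.
under [in X in _ = X -> _]eq_bigr do rewrite /= L1 mulr1.
move=> avg; rewrite -(@ler_pM2l _ (2 ^+ #|T|)) ?exprn_gt0// -avg.
have <- : \sum_(E : {set T}) (B * (C * K)) = 2 ^+ #|T| * (B * (C * K)).
  rewrite sumr_const -[#|_|]cardsT -powersetT card_powerset cardsT.
  by rewrite -natrX mulr_natl.
apply: ler_sum => E _; apply: (le_trans (LB _ _)).
by apply: ler_wpM2l => //; apply: (le_trans (PC _)); exact: ler_wpM2l.
Qed.

(** * Square waves, and integrals of periodic functions *)

Section square_wave.
Context {R : realType}.
Implicit Types (x t : R) (k n : nat).

Let fl x : R := (Num.floor x)%:~R.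

(** The value is 1 on [2 z, 2 z + 1[ and - 1 on [2 z + 1, 2 z + 2[, z an
    integer. Written with floors it is visibly a combination of monotone
    functions, hence measurable. *)
Definition square_wave x : R := 1 - 2 * fl x + 4 * fl (x / 2).

Let fl_eq (z : int) x : z%:~R <= x -> x < z%:~R + 1 -> fl x = z%:~R.
Proof.
move=> zx xz; congr (_%:~R); apply/eqP.
by rewrite floor_eq zx/= intrD.
Qed.

Lemma square_wave_cases x : exists z : int,
  (2 * z%:~R <= x < 2 * z%:~R + 1 /\ square_wave x = 1) \/
  (2 * z%:~R + 1 <= x < 2 * z%:~R + 2 /\ square_wave x = -1).
Proof.
pose z := Num.floor (x / 2); exists z.
have /andP[zx xz] : z%:~R <= x / 2 < z%:~R + 1.
  by have := floor_itv (x / 2); rewrite intrD.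
have flz : fl (x / 2) = z%:~R by [].
have e2 : (z * 2)%:~R = 2 * z%:~R :> R by rewrite intrM mulrC.
have e3 : (z * 2 + 1)%:~R = 2 * z%:~R + 1 :> R by rewrite intrD e2.
case: (ltP x (2 * z%:~R + 1)) => h; [left|right]; split; try lra.
- have := @fl_eq (z * 2) x; rewrite e2 /square_wave flz => -> //; lra.
- have := @fl_eq (z * 2 + 1) x; rewrite e3 /square_wave flz => ->; lra.
Qed.

Lemma square_waveE1 (z : int) x : 2 * z%:~R <= x < 2 * z%:~R + 1 ->
  square_wave x = 1.
Proof.
move=> /andP[h1 h2].
have e2 : (z * 2)%:~R = 2 * z%:~R :> R by rewrite intrM mulrC.
have -> : square_wave x = 1 - 2 * (2 * z%:~R) + 4 * z%:~R; last lra.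
by rewrite /square_wave (@fl_eq (z * 2) x) ?e2//; rewrite (@fl_eq z)//; lra.
Qed.

Lemma square_waveEN1 (z : int) x : 2 * z%:~R + 1 <= x < 2 * z%:~R + 2 ->
  square_wave x = -1.
Proof.
move=> /andP[h1 h2].
have e2 : (z * 2 + 1)%:~R = 2 * z%:~R + 1 :> R by rewrite intrD intrM mulrC.
have -> : square_wave x = 1 - 2 * (2 * z%:~R + 1) + 4 * z%:~R; last lra.
by rewrite /square_wave (@fl_eq (z * 2 + 1) x) ?e2//;
  [rewrite (@fl_eq z)//; lra|lra].
Qed.

Lemma square_wave_sqr x : square_wave x ^+ 2 = 1.
Proof. by have [z [] [_ ->]] := square_wave_cases x; rewrite ?sqrrN expr1n. Qed.

Lemma square_waveD1 x : square_wave (x + 1) = - square_wave x.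
Proof.
have [z [] [/andP[h1 h2] ->]] := square_wave_cases x.
  by apply: (@square_waveEN1 z); lra.
rewrite opprK; apply: (@square_waveE1 (z + 1)); rewrite intrD; lra.
Qed.

Lemma square_waveDnat x n : square_wave (x + n%:R) = (-1) ^+ n * square_wave x.
Proof.
elim: n => [|n IH]; first by rewrite addr0 expr0 mul1r.
by rewrite -natr1 addrA square_waveD1 IH exprS mulN1r mulNr.
Qed.

Lemma square_wave_nat n x : n%:R <= x < n%:R + 1 -> square_wave x = (-1) ^+ n.
Proof.
move=> /andP[nx xn]; rewrite -(subrK n%:R x) square_waveDnat.
by rewrite (@square_waveE1 0) ?mulr1//; lra.
Qed.

Lemma measurable_square_wave (D : set R) : measurable_fun D square_wave.
Proof.
apply: (@measurable_funS _ _ _ _ setT) => //.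
have mfl : measurable_fun [set: R] fl.
  by apply: nondecreasing_measurable => // x y xy; rewrite ler_int le_floor.
apply: measurable_funD; first apply: measurable_funB => //.
  by apply: measurable_funM.
apply: measurable_funM => //; apply: measurableT_comp => //.
by apply: measurable_funM.
Qed.

(** At an integer x the left-hand side is 0 but the right-hand side is not. *)
Lemma sg_sin_square_wave x : 0 <= x -> (forall n, x != n%:R) ->
  Num.sg (sin (pi * x)) = square_wave x.
Proof.
move=> x0 xN; pose n := Num.truncn x.
have /andP[nx xn] : n%:R <= x < n.+1%:R by exact: truncn_itv.
have {}nx : n%:R < x by rewrite lt_neqAle nx eq_sym xN.
rewrite (@square_wave_nat n); last first.
  by apply/andP; split; [exact: ltW|rewrite natr1].
have -> : pi * x = pi * (x - n%:R) + pi *+ n by rewrite -mulr_natr; lra.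
have -> : sin (pi * (x - n%:R) + pi *+ n) = (-1) ^+ n * sin (pi * (x - n%:R)).
  elim: n {nx xn} (pi * _) => [|n IH] y; first by rewrite mulr0n addr0 mul1r.
  by rewrite mulrS addrA IH sinDpi exprS mulN1r mulrN mulNr.
have s0 : 0 < sin (pi * (x - n%:R)).
  apply: sin_gt0_pi; rewrite mulr_gt0 ?pi_gt0//= ?subr_gt0//.
  by rewrite -[ltRHS]mulr1 ltr_pM2l ?pi_gt0// ltrBlDl natr1.
by rewrite sgrM (gtr0_sg s0) mulr1 sgrX sgrN1.
Qed.

End square_wave.

Section integration.
Context {R : realType}.
Local Notation mu := (@lebesgue_measure R).
Implicit Types (f g : R -> R) (a b s : R) (n : nat).

Definition translation s : measurableTypeR R -> measurableTypeR R :=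
  fun x => x + s.

Let measurable_translation s : measurable_fun setT (translation s).
Proof. by apply: measurable_funD. Qed.

HB.instance Definition _ s :=
  isMeasurableFun.Build _ _ _ _ (translation s) (measurable_translation s).

Lemma translation_itvco s a b :
  translation s @^-1` `[a + s, b + s[ = `[a, b[%classic.
Proof. by apply/seteqP; split => x /=; rewrite !in_itv/= lerD2r ltrD2r. Qed.

Lemma lebesgue_measure_translation s (A : set R) : measurable A ->
  pushforward mu (translation s) A = mu A.
Proof.
move=> mA; apply/esym/lebesgue_measure_unique => //= _ [[a b]] _ <-.
rewrite /pushforward/=.
have -> : translation s @^-1` `]a, b] = `]a - s, b - s]%classic.
  by apply/seteqP; split => x /=; rewrite !in_itv/= ltrBlDr lerBrDr.
have E (c d : R) : mu `]c, d] = if c < d then (d - c)%:E else 0%E.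
  by rewrite lebesgue_measure_itv/= lte_fin -EFinB.
apply: (etrans (E a b)); apply: (etrans _ (esym (E _ _))).
by rewrite ltrD2r; case: ifP => // _; congr EFin; lra.
Qed.

(** Integrals are taken over half-open intervals, for which consecutive
    intervals are disjoint and translates again half-open. *)
Definition loc_integrable f : Prop :=
  forall a b, mu.-integrable `[a, b[ (EFin \o f).

Lemma bounded_loc_integrable f K : measurable_fun setT f ->
  (forall x, `|f x| <= K) -> loc_integrable f.
Proof.
move=> mf fK a b; apply: measurable_bounded_integrable => //.
- by rewrite /= lebesgue_measure_itv/=; case: ifP => // _; rewrite -EFinB ltry.
- exact: measurable_funS mf.
- exists K; split; first exact: num_real.
  by move=> M KM x _ /=; exact: le_trans (fK x) (ltW KM).
Qed.

Lemma Rintegral_split f a b c : loc_integrable f -> a <= b -> b <= c ->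
  \int[mu]_(x in `[a, c[) f x =
  \int[mu]_(x in `[a, b[) f x + \int[mu]_(x in `[b, c[) f x.
Proof.
move=> lf ab bc; rewrite -Rintegral_setU//.
- by rewrite -itv_bndbnd_setU ?bnd_simp.
- by rewrite -itv_bndbnd_setU ?bnd_simp.
- apply/disj_setPS => y [/=]; rewrite 2!in_itv/= => /andP[_ yx] /andP[].
  by rewrite leNgt yx.
Qed.

Lemma Rintegral_shift f a b s : measurable_fun setT f ->
  loc_integrable (fun x => f (x + s)) ->
  \int[mu]_(x in `[a + s, b + s[) f x = \int[mu]_(x in `[a, b[) f (x + s).
Proof.
move=> mf lf; rewrite /Rintegral; congr fine.
have := @integral_pushforward _ _ _ _ R _ (measurable_translation s) mu
  `[a + s, b + s[%classic (EFin \o f).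
rewrite translation_itvco /= => <-//.
- apply: eq_measure_integral => A mA _.
  exact/esym/lebesgue_measure_translation.
- exact/measurable_EFinP.
Qed.

Lemma Rintegral_periods f a T v n : loc_integrable f -> 0 <= T ->
  (forall b, \int[mu]_(x in `[b, b + T[) f x = v) ->
  \int[mu]_(x in `[a, a + n%:R * T[) f x = n%:R * v.
Proof.
move=> lf T0 fv; elim: n => [|n IH].
  by rewrite !mul0r addr0 set_itv_ge ?bnd_simp ?ltxx// Rintegral_set0.
rewrite (@Rintegral_split _ _ (a + n%:R * T))//; last 2 first.
- by rewrite lerDl mulr_ge0.
- by rewrite lerD2l ler_wpM2r// ler_nat.
have -> : a + n.+1%:R * T = a + n%:R * T + T by rewrite -natr1; lra.
by rewrite IH fv -natr1; lra.
Qed.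

(** The two halves of each period 2 s cancel. *)
Lemma Rintegral_antiperiodic f a s n : measurable_fun setT f ->
  loc_integrable f -> 0 <= s -> (forall x, f (x + s) = - f x) ->
  \int[mu]_(x in `[a, a + n%:R * (2 * s)[) f x = 0.
Proof.
move=> mf lf s0 fs.
rewrite (@Rintegral_periods _ _ _ 0) ?mulr0 ?mulr_ge0// => b.
rewrite (@Rintegral_split _ _ (b + s))//; [|lra|lra].
have -> : b + 2 * s = (b + s) + s by lra.
have NE : (fun x => f (x + s)) = (fun x => -1 * f x).
  by apply/funext => x; rewrite fs mulN1r.
rewrite (@Rintegral_shift f b (b + s) s)//; last first.
  rewrite NE => c d.
  by apply: (integrableZl _ (-1) (lf c d)).
under [X in _ + X]eq_Rintegral do rewrite fs -mulN1r.
by rewrite RintegralZl//; lra.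
Qed.

(** The interval is covered by at most (b - a) / T + 1 periods, over each of
    which the nonnegative f has integral T. *)
Lemma Rintegral_periodic_le f a b T : loc_integrable f ->
  (forall x, 0 <= f x) -> 0 < T -> a <= b ->
  (forall c, \int[mu]_(x in `[c, c + T[) f x = T) ->
  \int[mu]_(x in `[a, b[) f x <= b - a + T.
Proof.
move=> lf f0 T0 ab fT; pose n := Num.truncn ((b - a) / T).
have /andP[n1 n2] : n%:R <= (b - a) / T < n.+1%:R.
  by apply: truncn_itv; rewrite divr_ge0 ?subr_ge0// ltW.
apply: (@le_trans _ _ (n.+1%:R * T)); last first.
  by rewrite -natr1 mulrDl mul1r lerD2r -ler_pdivlMr.
rewrite -(@Rintegral_periods f a T T n.+1)//; last exact: ltW.
have bE : b <= a + n.+1%:R * T by rewrite -lerBlDl -ler_pdivrMr// ltW.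
rewrite (@Rintegral_split _ a b (a + n.+1%:R * T))// lerDl.
by apply: Rintegral_ge0.
Qed.

End integration.

(** * Orthogonality of Walsh functions, and sparse Riesz products *)

Section bounded_measurable.
Context {R : realType}.
Local Notation mu := (@lebesgue_measure R).
Implicit Types (f g : R -> R).

Definition bounded_measurable f : Prop :=
  measurable_fun setT f /\ exists K, forall x, `|f x| <= K.

Lemma bounded_measurable_cst c : bounded_measurable (fun=> c).
Proof. by split; [exact: measurable_cst|exists `|c|]. Qed.

Lemma bounded_measurableD f g : bounded_measurable f -> bounded_measurable g ->
  bounded_measurable (fun x => f x + g x).
Proof.
move=> [mf [K fK]] [mg [L gL]]; split; first exact: measurable_funD.
by exists (K + L) => x; apply: (le_trans (ler_normD _ _)); exact: lerD.
Qed.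

Lemma bounded_measurableM f g : bounded_measurable f -> bounded_measurable g ->
  bounded_measurable (fun x => f x * g x).
Proof.
move=> [mf [K fK]] [mg [L gL]]; split; first exact: measurable_funM.
by exists (K * L) => x; rewrite normrM; exact: ler_pM.
Qed.

Lemma bounded_measurable_prod (I : Type) (r : seq I) (Q : pred I)
    (f : I -> R -> R) :
  (forall i, bounded_measurable (f i)) ->
  bounded_measurable (fun x => \prod_(i <- r | Q i) f i x).
Proof.
move=> bf; elim: r => [|i r IH].
  by under eq_fun do rewrite big_nil; exact: bounded_measurable_cst.
under eq_fun do rewrite big_cons.
by case: (Q i) => //; exact: bounded_measurableM.
Qed.

Lemma bounded_measurable_integrable f :
  bounded_measurable f -> loc_integrable f.
Proof. by move=> [mf [K fK]]; exact: bounded_loc_integrable fK. Qed.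

Lemma bounded_measurable_sum (I : Type) (r : seq I) (f : I -> R -> R) :
  (forall i, bounded_measurable (f i)) ->
  bounded_measurable (fun x => \sum_(i <- r) f i x).
Proof.
move=> bf; elim: r => [|i r IH].
  by under eq_fun do rewrite big_nil; exact: bounded_measurable_cst.
by under eq_fun do rewrite big_cons; exact: bounded_measurableD.
Qed.

Lemma bounded_measurable_Rintegral_sum (I : Type) (r : seq I)
    (f : I -> R -> R) a b :
  (forall i, bounded_measurable (f i)) ->
  \int[mu]_(x in `[a, b[) (\sum_(i <- r) f i x) =
  \sum_(i <- r) \int[mu]_(x in `[a, b[) f i x.
Proof.
move=> bf; elim: r => [|i r IH].
  under eq_Rintegral do rewrite big_nil.
  by rewrite big_nil Rintegral_cst// mul0r.
under eq_Rintegral do rewrite big_cons.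
rewrite big_cons RintegralD ?IH//; apply: bounded_measurable_integrable => //.
exact: bounded_measurable_sum.
Qed.

End bounded_measurable.

Section dyadic_rademacher.
Context {R : realType}.
Local Notation mu := (@lebesgue_measure R).
Implicit Types (t : R) (k j : nat) (s : seq nat).

(** A version of the Rademacher function with no zeros and with exact periods:
    products of such functions can be simplified pointwise, and not only
    almost everywhere. *)
Definition dyadic_rademacher k t : R := square_wave (2 ^+ k * t).
Local Notation rho := dyadic_rademacher.

Lemma dyadic_rademacher_sqr k t : rho k t ^+ 2 = 1.
Proof. exact: square_wave_sqr. Qed.

Lemma dyadic_rademacher_norm k t : `|rho k t| = 1.
Proof.
apply/eqP; rewrite -sqrp_eq1// real_normK ?num_real//.
by rewrite dyadic_rademacher_sqr.
Qed.

Lemma bounded_measurable_dyadic_rademacher k : bounded_measurable (rho k).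
Proof.
split; last by exists 1 => x; rewrite dyadic_rademacher_norm.
apply: (@measurableT_comp _ _ _ _ _ _ (@square_wave R) _
  (fun t => 2 ^+ k * t)).
  exact: measurable_square_wave.
by apply: measurable_funM.
Qed.

Lemma dyadic_rademacher_period k j t : (j < k)%N ->
  rho k (t + 2 ^- j) = rho k t.
Proof.
move=> jk; rewrite /rho mulrDr.
have -> : 2 ^+ k * 2 ^- j = (2 ^ (k - j))%:R :> R.
  by rewrite -[in LHS](subnK (ltnW jk)) exprD mulfK ?natrX// expf_neq0.
rewrite square_waveDnat -signr_odd oddX subn_eq0 leqNgt jk/=.
by rewrite expr0 mul1r.
Qed.

Lemma dyadic_rademacher_antiperiod k t : rho k (t + 2 ^- k) = - rho k t.
Proof. by rewrite /rho mulrDr divff ?expf_neq0// square_waveD1. Qed.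

Lemma dyadic_rademacherE k j t : j%:R / 2 ^+ k <= t < j.+1%:R / 2 ^+ k ->
  rho k t = (-1) ^+ j.
Proof.
move=> /andP[jt tj]; apply: square_wave_nat.
by rewrite mulrC -ler_pdivrMr ?exprn_gt0// jt natr1 -ltr_pdivlMr ?exprn_gt0.
Qed.

(** The two functions can differ only at multiples of 2 ^- k. *)
Lemma ae_eq_rademacher k : ae_eq mu unit_itv (rademacher k) (rho k).
Proof.
pose N : set R := range (fun j : nat => j%:R / 2 ^+ k).
have cN : countable N.
  exact: sub_countable (card_image_le _ _) (countableP _).
exists N; split.
- exact: countable_measurable.
- exact: countable_lebesgue_measure0.
move=> t /= tN; apply: contrapT => Nt; apply: tN.
rewrite /unit_itv/= in_itv/= => /andP[t0 t1].
rewrite /rademacher /rho -mulrA [pi * _]mulrC mulrA [_ * pi]mulrC.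
apply: sg_sin_square_wave; first by rewrite mulr_ge0 ?exprn_ge0.
move=> n; apply/eqP => tn; apply: Nt; exists n => //.
by rewrite -tn mulrC mulKf ?expf_neq0.
Qed.

(** For the least index k of s, a shift by 2 ^- k changes the sign of rho k
    and is a period of the other factors. *)
Lemma walsh_integral0 s : s != [::] -> uniq s -> all (leq 1) s ->
  \int[mu]_(t in `[0, 1[) (\prod_(k <- s) rho k t) = 0.
Proof.
move=> s0 us s1.
have exk : exists k, k \in s.
  by case: s s0 {us s1} => // k s _; exists k; rewrite mem_head.
case: (ex_minnP exk) => k ks kmin.
have k0 : (0 < k)%N by exact: (allP s1).
have bm : bounded_measurable (fun t => \prod_(j <- s) rho j t).
  apply: bounded_measurable_prod => j.
  exact: bounded_measurable_dyadic_rademacher.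
have := @Rintegral_antiperiodic R (fun t => \prod_(j <- s) rho j t) 0
  (2 ^- k) (2 ^ k.-1).
have -> : 0 + (2 ^ k.-1)%:R * (2 * 2 ^- k) = 1 :> R.
  rewrite add0r mulrA natrX -exprSr prednK// divff// expf_neq0//.
apply => //; [by case: bm|exact: bounded_measurable_integrable|].
move=> t; rewrite !(bigD1_seq k)//= dyadic_rademacher_antiperiod mulNr.
congr (- (_ * _)); rewrite big_seq_cond [RHS]big_seq_cond.
apply: eq_bigr => j /andP[js jk]; apply: dyadic_rademacher_period.
by rewrite ltn_neqAle eq_sym jk kmin.
Qed.

(** If k occurs in s the two factors rho k cancel, otherwise k :: s is again
    free of repetitions; in both cases a Walsh function remains, of integral 0
    unless no factor is left. *)
Lemma walsh_rademacher_integral k s : (0 < k)%N -> uniq s -> all (leq 1) s ->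
  \int[mu]_(t in `[0, 1[) (rho k t * \prod_(j <- s) rho j t) = (s == [:: k])%:R.
Proof.
move=> k0 us s1; have [ks|ks] := boolP (k \in s); last first.
  have -> : (s == [:: k]) = false.
    by apply/eqP => sk; move: ks; rewrite sk mem_head.
  have E t : rho k t * \prod_(j <- s) rho j t = \prod_(j <- k :: s) rho j t.
    by rewrite big_cons.
  under eq_Rintegral do rewrite E.
  by apply: walsh_integral0 => //=; rewrite ?ks ?k0.
have E t : rho k t * \prod_(j <- s) rho j t = \prod_(j <- rem k s) rho j t.
  rewrite (perm_big _ (perm_to_rem ks)) big_cons mulrA -expr2.
  by rewrite dyadic_rademacher_sqr mul1r.
under eq_Rintegral do rewrite E.
have pk := perm_to_rem ks.
case: (eqVneq (rem k s) [::]) => [r0|r0].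
  have -> : s = [:: k] by apply/perm_small_eq => //; rewrite -r0.
  rewrite eqxx /= eqxx; under eq_Rintegral do rewrite big_nil.
  rewrite Rintegral_cst//= lebesgue_measure_itv/= lte_fin ltr01.
  by rewrite oppr0 adde0 mulr1.
have -> : (s == [:: k]) = false.
  by apply/eqP => sk; move: r0; rewrite sk /= eqxx.
apply: walsh_integral0 => //; first exact: rem_uniq.
by apply/allP => j /mem_rem; apply: (allP s1).
Qed.

(** Integration against a Rademacher function selects the degree-one part of
    the Riesz product. *)
Lemma riesz_rademacher_integral m (kappa : nat -> nat) (r : R)
    (E : {set 'I_m}) k :
  (forall i, (0 < kappa i)%N) -> injective kappa -> (0 < k)%N ->
  \int[mu]_(t in `[0, 1[)
    (rho k t * riesz r (fun i : 'I_m => cube_sign R E i * rho (kappa i) t)) =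
  r * \sum_i cube_sign R E i * (kappa i == k)%:R.
Proof.
move=> kappa0 kappaI k0.
pose W (A : {set 'I_m}) t : R :=
  rho k t * \prod_(j <- [seq kappa (val i) | i <- enum A]) rho j t.
have bW A : bounded_measurable (W A).
  apply: bounded_measurableM; first exact: bounded_measurable_dyadic_rademacher.
  apply: bounded_measurable_prod => j.
  exact: bounded_measurable_dyadic_rademacher.
pose c (A : {set 'I_m}) : R := riesz_coef r A * \prod_(i in A) cube_sign R E i.
transitivity (\int[mu]_(t in `[0, 1[) \sum_(A : {set 'I_m}) c A * W A t).
  apply: eq_Rintegral => t _; rewrite riesz_expansion mulr_sumr.
  apply: eq_bigr => A _; rewrite /c /W big_split/= big_map big_enum/=.
  by rewrite [LHS]mulrCA -[RHS]mulrA; congr (_ * _); rewrite mulrCA.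
rewrite bounded_measurable_Rintegral_sum; last first.
  by move=> A; apply: bounded_measurableM => //; exact: bounded_measurable_cst.
transitivity (\sum_(A : {set 'I_m})
    c A * ([seq kappa (val i) | i <- enum A] == [:: k])%:R).
  apply: eq_bigr => A _.
  rewrite RintegralZl//; last exact: bounded_measurable_integrable.
  rewrite walsh_rademacher_integral//.
  - by rewrite map_inj_uniq ?enum_uniq// => i j /kappaI /val_inj.
  - by apply/allP => j /mapP[i _ ->].
have [[i0 i0k]|Nk] := pselect (exists i : 'I_m, kappa i = k).
  rewrite (bigD1 [set i0]%SET)//= enum_set1/= i0k eqxx mulr1.
  rewrite big1 ?addr0; last first.
    move=> A Ai0; case: eqP => [e|]; last by rewrite mulr0.
    case/negP: Ai0; apply/eqP/setP => i; rewrite inE.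
    have : (kappa i \in [seq kappa (val i) | i <- enum A]) = (i \in A).
      rewrite (mem_map (f := fun i : 'I_m => kappa i)) ?mem_enum// => x y.
      by move=> /kappaI /val_inj.
    by rewrite e inE -i0k (inj_eq kappaI) => <-.
  rewrite (bigD1 i0)//= i0k eqxx mulr1.
  rewrite big1 ?addr0 /c ?riesz_coef1 ?big_set1// => i ii0.
  rewrite -i0k (inj_eq kappaI) -val_eqE/= in ii0 *.
  by rewrite (negbTE ii0) mulr0.
rewrite big1 ?big1 ?mulr0// => [i _|A _].
  by case: eqP => [ik|]; [case: Nk; exists i|rewrite mulr0].
case: eqP => [e|]; last by rewrite mulr0.
case: Nk; have : k \in [seq kappa (val i) | i <- enum A] by rewrite e mem_head.
by case/mapP => i _ ->; exists i.
Qed.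

(** The first factor contributes the integral of the remaining product plus
    that of rho (kappa p) times it, and the latter is antiperiodic with
    half-period 2 ^- kappa p; induction removes the factors one by one. *)
Lemma rademacher_tail_integral (kappa : nat -> nat) (sigma : nat -> R) d p q a :
  {homo kappa : i j / (i < j)%N} -> (q < kappa p)%N ->
  \int[mu]_(t in `[a, a + 2 ^- q[)
    (\prod_(p <= i < p + d) (1 + sigma i * rho (kappa i) t)) = 2 ^- q.
Proof.
move=> kappaI; elim: d p => [|d IH] p qp.
  under eq_Rintegral do rewrite addn0 big_geq//.
  rewrite Rintegral_cst//= lebesgue_measure_itv/= lte_fin ltrDl invr_gt0.
  rewrite exprn_gt0//=.
  by rewrite mul1r; lra.
pose g t : R := \prod_(p.+1 <= i < p.+1 + d) (1 + sigma i * rho (kappa i) t).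
have bg : bounded_measurable g.
  apply: bounded_measurable_prod => i; apply: bounded_measurableD.
    exact: bounded_measurable_cst.
  apply: bounded_measurableM; first exact: bounded_measurable_cst.
  exact: bounded_measurable_dyadic_rademacher.
have brg : bounded_measurable (fun t => rho (kappa p) t * g t).
  apply: bounded_measurableM => //.
  exact: bounded_measurable_dyadic_rademacher.
have gE t : \prod_(p <= i < p + d.+1) (1 + sigma i * rho (kappa i) t) =
    g t + sigma p * (rho (kappa p) t * g t).
  rewrite addnS -addSn big_ltn; last by rewrite addSn ltnS leq_addr.
  by rewrite mulrDl mul1r -mulrA.
under eq_Rintegral do rewrite gE.
rewrite RintegralD//; [|exact: bounded_measurable_integrable|]; last first.
  apply: bounded_measurable_integrable; apply: bounded_measurableM => //.
  exact: bounded_measurable_cst.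
rewrite {1}/g IH; last by apply: (ltn_trans qp); exact: kappaI.
rewrite RintegralZl//; last exact: bounded_measurable_integrable.
have := @Rintegral_antiperiodic R (fun t => rho (kappa p) t * g t) a
  (2 ^- kappa p) (2 ^ (kappa p - q).-1).
have -> : (2 ^ (kappa p - q).-1)%:R * (2 * 2 ^- kappa p) = 2 ^- q :> R.
  rewrite mulrA natrX -exprSr prednK ?subn_gt0//.
  rewrite -[X in _ / 2 ^+ X](subnK (ltnW qp)) exprD invfM mulrA divff ?mul1r//.
move=> ->; rewrite ?mulr0 ?addr0//.
- by case: brg.
- exact: bounded_measurable_integrable.
move=> t; rewrite dyadic_rademacher_antiperiod mulNr; congr (- (_ * _)).
apply: eq_big_nat => i /andP[pi _]; rewrite dyadic_rademacher_period//.
exact: kappaI.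
Qed.

(** The factors before p are at most 2. The product of the others has mean 1
    over a period 2 ^- (kappa p).-1, which is at most 2 (b - a). *)
Lemma sparse_product_integral_le (kappa : nat -> nat) (sigma : nat -> R)
    m p a b :
  {homo kappa : i j / (i < j)%N} -> (0 < kappa 0)%N ->
  (forall i, `|sigma i| = 1) ->
  (p <= m)%N -> a <= b -> (p < m)%N ==> (2 ^- kappa p <= b - a) ->
  \int[mu]_(t in `[a, b[)
    (\prod_(0 <= i < m) (1 + sigma i * rho (kappa i) t)) <=
  2 ^+ p * (3 * (b - a)).
Proof.
move=> kappaI kappa0 sigma1 pm ab pab.
have kappa_gt0 i : (0 < kappa i)%N.
  by case: i => // i; apply: (ltn_trans kappa0); exact: kappaI.
have sr i t : `|sigma i * rho (kappa i) t| = 1.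
  by rewrite normrM sigma1 dyadic_rademacher_norm mul1r.
have f0 i t : 0 <= 1 + sigma i * rho (kappa i) t.
  by have := ler_norm (- (sigma i * rho (kappa i) t)); rewrite normrN sr; lra.
have f2 i t : 1 + sigma i * rho (kappa i) t <= 2.
  by have := ler_norm (sigma i * rho (kappa i) t); rewrite sr; lra.
have bF n1 n2 : bounded_measurable
    (fun t => \prod_(n1 <= i < n2) (1 + sigma i * rho (kappa i) t)).
  apply: bounded_measurable_prod => i; apply: bounded_measurableD.
    exact: bounded_measurable_cst.
  apply: bounded_measurableM; first exact: bounded_measurable_cst.
  exact: bounded_measurable_dyadic_rademacher.
apply: (@le_trans _ _ (\int[mu]_(t in `[a, b[)
    (2 ^+ p * \prod_(p <= i < m) (1 + sigma i * rho (kappa i) t)))).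
  apply: le_Rintegral => //.
  - exact: bounded_measurable_integrable.
  - apply: bounded_measurable_integrable; apply: bounded_measurableM => //.
    exact: bounded_measurable_cst.
  move=> t _; rewrite (@big_cat_nat _ _ _ p 0 m)//=; apply: ler_wpM2r.
    by apply: prodr_ge0.
  have -> : 2 ^+ p = \prod_(0 <= i < p) 2 :> R by rewrite prodr_const_nat subn0.
  by apply: ler_prod => i _; rewrite f0 f2.
rewrite RintegralZl//; last exact: bounded_measurable_integrable.
apply: ler_wpM2l; first exact: exprn_ge0.
move: pm; rewrite leq_eqVlt => /orP[/eqP pm|pm].
  under eq_Rintegral do rewrite big_geq ?pm//.
  rewrite Rintegral_cst//= lebesgue_measure_itv/= lte_fin.
  by case: ltP => [_|ba]; rewrite /= mul1r; lra.
rewrite pm/= in pab.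
have T2 : 2 ^- (kappa p).-1 = 2 * 2 ^- kappa p :> R.
  rewrite -[in RHS](prednK (kappa_gt0 p)) exprS invfM mulrA divff ?mul1r//.
apply: (@le_trans _ _ (b - a + 2 ^- (kappa p).-1)).
  apply: Rintegral_periodic_le => //.
  - exact: bounded_measurable_integrable.
  - by move=> t; exact: prodr_ge0.
  - move=> c; rewrite -(subnKC (ltnW pm)).
    apply: rademacher_tail_integral => //.
    by rewrite prednK.
rewrite T2; lra.
Qed.

End dyadic_rademacher.

(** * Bounded functionals and norm estimates on the Morrey space *)

Section closed_span.
Context {R : realType} {V : normedModType R}.
Implicit Types (A : set V) (L : V -> R).

(** The span is dense in its closure, and L is continuous with respect to the
    a priori constant K; only the better constant B is wanted. *)
Lemma closed_linear_span_bound A L (K B : R) :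
  linear_for *%R L -> (forall x, `|L x| <= K * `|x|) -> 0 <= B ->
  (forall x, linear_span A x -> `|L x| <= B * `|x|) ->
  forall x, closed_linear_span A x -> `|L x| <= B * `|x|.
Proof.
move=> linL LK B0 LB x clx.
have K0 : 0 <= `|K| by [].
apply/ler_addgt0Pr => e e0.
have d0 : 0 < e / (`|K| + B + 1) by apply: divr_gt0 => //; lra.
have [y [Ay]] : linear_span A `&` ball x (e / (`|K| + B + 1)) !=set0.
  exact: clx (nbhsx_ballx _ _ d0).
rewrite -ball_normE/= => xy.
have -> : L x = L (x - y) + L y.
  by rewrite -[in LHS](subrK y x) -[X in L (X + y)]scale1r linL mul1r.
have h1 : `|L (x - y)| <= `|K| * `|x - y|.
  by apply: (le_trans (LK _)); apply: ler_wpM2r => //; exact: ler_norm.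
have h2 : `|y| <= `|x| + `|x - y|.
  by rewrite -{1}(subKr x y) (le_trans (ler_normB _ _)).
have h3 : (`|K| + B + 1) * `|x - y| < e by rewrite mulrC -ltr_pdivlMr//; lra.
have h4 := LB _ Ay.
have h5 := ler_wpM2l B0 h2.
have h6 := normr_ge0 (x - y).
apply: (le_trans (ler_normD _ _)); rewrite mulrDr in h5; lra.
Qed.

End closed_span.

Section morrey_pairing.
Context {R : realType} {w : R -> R}.
Variables (hw : quasi_concave w) (w1 : w 1 = 1).
Local Notation mu := (@lebesgue_measure R).
Local Notation M := (morrey hw w1).

Lemma integral_morrey_fun_le (f : morrey_fun hw) :
  (\int[mu]_(t in unit_itv) `|f t|%:E <= `|morrey_class w1 f|%:E)%E.
Proof.
rewrite (morrey_normE w1 f); apply: ereal_sup_ubound.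
exists `[0, 1]; first exact: nondegenerate_unit_itv.
by rewrite /itv_length lebesgue_measure_unit_itv/= w1 divr1 mul1e.
Qed.

Lemma morrey_fun_integrable (f : morrey_fun hw) :
  mu.-integrable unit_itv (EFin \o f).
Proof.
apply/integrableP; split.
  by apply/measurable_EFinP; exact: (morrey_fun_measurable f).
exact: le_lt_trans (integral_morrey_fun_le f) (ltry _).
Qed.

Lemma unit_itvco_sub : `[0, 1[%classic `<=` @unit_itv R.
Proof. by move=> t /=; rewrite /unit_itv/= !in_itv/= => /andP[-> /ltW]. Qed.

(** A linear functional on classes, which does not depend on the
    representative. Leaving out the point 1 does not change the integral and
    gives access to the results on half-open intervals. *)
Definition pairing (g : R -> R) (x : M) : R :=
  \int[mu]_(t in `[0, 1[) (morrey_repr x t * g t).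

Section bounded_test.
Variables (g : R -> R) (bg : bounded_measurable g).

Lemma pairing_integrable (f : morrey_fun hw) :
  mu.-integrable `[0, 1[ (EFin \o (fun t => f t * g t)).
Proof.
have [mg [K gK]] := bg.
have fi : mu.-integrable `[0, 1[ (EFin \o f).
  apply: integrableS (morrey_fun_integrable f) => //.
    exact: measurable_itv.
  exact: unit_itvco_sub.
have := @integrableMl _ _ _ mu `[0, 1[%classic _ (EFin \o f) g fi.
apply => //; first exact: measurable_funS mg.
exists K; split; first exact: num_real.
by move=> x Kx t _ /=; exact: le_trans (gK t) (ltW Kx).
Qed.

Lemma pairing_class (f : morrey_fun hw) :
  pairing g (morrey_class w1 f) = \int[mu]_(t in `[0, 1[) (f t * g t).
Proof.
have ae := iffLR (morrey_classP w1 _ _) (morrey_reprK (morrey_class w1 f)).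
rewrite /pairing /Rintegral; congr fine.
apply: ae_eq_integral => //.
- by have /integrableP[] :=
    pairing_integrable (morrey_repr (morrey_class w1 f)).
- by have /integrableP[] := pairing_integrable f.
by apply: filterS ae => t + /unit_itvco_sub t01 => /(_ t01) ->.
Qed.

Lemma pairing_linear : linear_for *%R (pairing g).
Proof.
move=> k x y; rewrite -(morrey_reprK x) -(morrey_reprK y).
set f := morrey_repr x; set h := morrey_repr y.
have -> : k *: morrey_class w1 f + morrey_class w1 h =
    morrey_class w1 (k *: f + h) by rewrite morrey_classD morrey_classZ.
rewrite !pairing_class -RintegralZl//; last exact: pairing_integrable.
rewrite -RintegralD//; last 2 first.
- by apply: (integrableZl _ k (pairing_integrable f)).
- exact: pairing_integrable.
by apply: eq_Rintegral => t _; rewrite [LHS]mulrDl -mulrA.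
Qed.

(** The weight is 1 at 1, so that the Morrey norm dominates the L^1 norm. *)
Lemma pairing_le K x : (forall t, `|g t| <= K) -> `|pairing g x| <= K * `|x|.
Proof.
move=> gK; have K0 : 0 <= K by exact: le_trans (gK 0).
rewrite -(morrey_reprK x); set f := morrey_repr x.
rewrite pairing_class -lee_fin EFin_normr_Rintegral//; last first.
  exact: pairing_integrable.
have fi := morrey_fun_integrable f.
apply: (le_trans (le_abse_integral _ _ _)) => //.
  by have /integrableP[] := pairing_integrable f.
rewrite EFinM.
apply: (@le_trans _ _ (K%:E * \int[mu]_(t in unit_itv) `|f t|%:E)%E);
  last first.
  by apply: lee_wpmul2l; rewrite ?lee_fin// integral_morrey_fun_le.
have mf : measurable_fun unit_itv (fun t => `|f t|%:E).
  apply/measurable_EFinP; apply: measurableT_comp => //.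
  exact: morrey_fun_measurable.
rewrite -ge0_integralZl//; last exact: measurable_unit_itv.
apply: (@le_trans _ _ (\int[mu]_(t in `[0%R, 1%R[) (K%:E * `|f t|%:E))%E).
  apply: ge0_le_integral => //.
  - apply: measurableT_comp => //.
    by have /integrableP[] := pairing_integrable f.
  - apply: measurable_funeM; apply: measurable_funS mf.
      exact: measurable_unit_itv.
    exact: unit_itvco_sub.
  - move=> t _ /=; rewrite lee_fin normrM mulrC.
    by apply: ler_wpM2r.
apply: ge0_subset_integral => //; last exact: unit_itvco_sub.
- exact: measurable_unit_itv.
- exact: measurable_funeM.
- by move=> t _; rewrite mule_ge0// lee_fin.
Qed.

End bounded_test.

Lemma lebesgue_measure_bounded_itv b1 b2 (a b : R) : a <= b ->
  mu [set` Interval (BSide b1 a) (BSide b2 b)] = (b - a)%:E.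
Proof.
move=> ab; rewrite lebesgue_measure_itv/= lte_fin; case: ltP => [_|ba] //.
have -> : a = b by lra.
by rewrite subrr.
Qed.

Lemma nondegenerate_subitvP I : nondegenerate_subitv I ->
  exists b1 b2 (a b : R), [/\ I = Interval (BSide b1 a) (BSide b2 b),
    0 <= a, a < b & b <= 1].
Proof.
case: I => l u [I01 I0].
have {}I01 t : t \in Interval l u -> 0 <= t <= 1.
  by move=> /I01; rewrite /unit_itv/= in_itv.
move: I0; rewrite lebesgue_measure_itv/=.
case: l u I01 => [b1 a|[]] [b2 b|[]] I01; rewrite /= ?ltxx//; last 3 first.
- have t01 : 0 <= Num.max a 1 + 1 <= 1.
    apply: I01; rewrite in_itv/= andbT.
    by case: b1 => /=; case: (leP a 1) => ?; lra.
  by exfalso; move: t01; case: (leP a 1) => ?; lra.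
- have t01 : 0 <= Num.min b 0 - 1 <= 1.
    apply: I01; rewrite in_itv/=.
    by case: b2 => /=; case: (leP b 0) => ?; lra.
  by exfalso; move: t01; case: (leP b 0) => ?; lra.
- by exfalso; have := I01 (-1) isT; lra.
rewrite lte_fin; case: (ltP a b) => [ab _|_]; last by rewrite ltxx.
have mid t : a < t < b -> 0 <= t <= 1.
  move=> /andP[at_ tb]; apply: I01; rewrite in_itv/=.
  by case: b1 b2 => -[] /=; rewrite ?at_ ?tb ?(ltW at_) ?(ltW tb).
exists b1, b2, a, b; split => //.
- rewrite leNgt; apply/negP => a0.
  have : 0 <= (a + Num.min b 0) / 2 <= 1.
    by apply: mid; case: (leP b 0) => ?; lra.
  by case: (leP b 0) => ?; lra.
- rewrite leNgt; apply/negP => b_gt1.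
  have : 0 <= (b + Num.max a 1) / 2 <= 1.
    by apply: mid; case: (leP a 1) => ?; lra.
  by case: (leP a 1) => ?; lra.
Qed.

Lemma bounded_measurable_norm_integral f a b : bounded_measurable f ->
  (\int[mu]_(t in `[a, b[) `|f t|%:E)%E =
  (\int[mu]_(t in `[a, b[) `|f t|)%:E.
Proof.
move=> bf; rewrite /Rintegral fineK//.
apply: integrable_fin_num => //.
exact: (integrable_norm (bounded_measurable_integrable bf a b)).
Qed.

(** Every nondegenerate subinterval of [0, 1] may be replaced by the half-open
    one with the same endpoints. *)
Lemma morrey_norm_le f K : bounded_measurable f ->
  (forall a b, 0 <= a -> a < b -> b <= 1 ->
     w (b - a) / (b - a) * \int[mu]_(t in `[a, b[) `|f t| <= K) ->
  (morrey_norm w f <= K%:E)%E.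
Proof.
move=> bf fK; apply: ge_ereal_sup => _ [I HI <-].
have [b1 [b2 [a [b [-> a0 ab b1']]]]] := nondegenerate_subitvP HI.
have mf : measurable_fun `]a, b[ (EFin \o (@Num.norm R R \o f)).
  apply/measurable_EFinP; apply: measurableT_comp => //.
  exact: measurable_funS bf.1.
rewrite integral_itv_bndoo// -(@integral_itv_bndoo _ _ _ _ true true)//.
rewrite bounded_measurable_norm_integral// /itv_length.
by rewrite lebesgue_measure_bounded_itv ?(ltW ab)// -EFinM lee_fin fK.
Qed.

Lemma bounded_morrey_norm_le f K : bounded_measurable f ->
  (forall t, `|f t| <= K) -> (morrey_norm w f <= K%:E)%E.
Proof.
move=> bf fK; have K0 : 0 <= K by exact: le_trans (fK 0).
apply: morrey_norm_le => // a b a0 ab b1.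
have ba0 : 0 < b - a by rewrite subr_gt0.
have h : \int[mu]_(t in `[a, b[) `|f t| <= K * (b - a).
  apply: (@le_trans _ _ (\int[mu]_(t in `[a, b[) K)); last first.
    by rewrite Rintegral_cst//= lebesgue_measure_bounded_itv// ltW.
  apply: le_Rintegral => //.
  - exact: (integrable_norm (bounded_measurable_integrable bf a b)).
  - exact: (bounded_measurable_integrable (bounded_measurable_cst K)).
have wba0 : 0 <= w (b - a) by apply: (quasi_concave_ge0 hw); lra.
have wba1 : w (b - a) <= 1.
  by rewrite -w1; apply: (quasi_concave_nondecreasing hw); lra.
apply: (@le_trans _ _ (w (b - a) / (b - a) * (K * (b - a)))).
  by apply: ler_wpM2l => //; rewrite divr_ge0// ltW.
by rewrite mulrCA divfK ?gt_eqF// ler_piMr.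
Qed.

Lemma bounded_measurable_morrey f : bounded_measurable f ->
  (f : R -> R^o) \in morrey_pred hw.
Proof.
move=> bf; rewrite inE; split; first exact: measurable_funS bf.1.
have [_ [K fK]] := bf.
exact: le_lt_trans (bounded_morrey_norm_le bf fK) (ltry _).
Qed.

Definition bounded_class f (bf : bounded_measurable f) : M :=
  morrey_class w1 (MorreyFun (bounded_measurable_morrey bf)).

Lemma bounded_class_norm f (bf : bounded_measurable f) :
  `|bounded_class bf|%:E = morrey_norm w f.
Proof. exact: morrey_normE. Qed.

Lemma rademacher_classE k : rademacher_class hw w1 k =
  bounded_class (bounded_measurable_dyadic_rademacher k).
Proof. by apply/morrey_classP; exact: ae_eq_rademacher. Qed.

Lemma pairing_bounded_class g f (bg : bounded_measurable g)
    (bf : bounded_measurable f) :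
  pairing g (bounded_class bf) = \int[mu]_(t in `[0, 1[) (f t * g t).
Proof. exact: pairing_class. Qed.

Lemma sum_bounded_class (I : finType) (c : I -> R) (f : I -> R -> R)
    (bf : forall i, bounded_measurable (f i)) g (bg : bounded_measurable g) :
  (forall t, g t = \sum_i c i * f i t) ->
  \sum_i c i *: bounded_class (bf i) = bounded_class bg.
Proof.
move=> gE.
have -> : \sum_i c i *: bounded_class (bf i) = morrey_class w1
    (\sum_i c i *: MorreyFun (bounded_measurable_morrey (bf i))).
  rewrite /morrey_class raddf_sum; apply: eq_bigr => i _.
  exact/esym/morrey_classZ.
congr morrey_class; apply: val_inj; rewrite raddf_sum /=.
by apply/funext => t; rewrite fct_sumE gE.
Qed.

(** Testing the norm on an interval where f is constant is how sup norms are
    bounded from below. *)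
Lemma bounded_class_lower f (bf : bounded_measurable f) a b v :
  0 <= a -> a < b -> b <= 1 -> (forall t, a <= t < b -> f t = v) ->
  w (b - a) * `|v| <= `|bounded_class bf|.
Proof.
move=> a0 ab b1 fv; rewrite -lee_fin bounded_class_norm.
have ba0 : 0 < b - a by rewrite subr_gt0.
have E : mu [set` `[a, b[] = (b - a)%:E.
  by rewrite lebesgue_measure_bounded_itv// ltW.
apply: ereal_sup_ubound; exists `[a, b[.
  split; last by rewrite E lte_fin.
  move=> t /=; rewrite /unit_itv/= !in_itv/= => /andP[h1 h2].
  by rewrite (le_trans a0 h1) (le_trans (ltW h2)).
rewrite /itv_length E/= bounded_measurable_norm_integral// -EFinM; congr EFin.
have -> : \int[mu]_(t in `[a, b[) `|f t| = \int[mu]_(t in `[a, b[) `|v|.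
  by apply: eq_Rintegral => t; rewrite inE/= in_itv/= => tab; rewrite fv.
by rewrite Rintegral_cst//= E/= mulrCA divfK ?gt_eqF// mulrC.
Qed.

End morrey_pairing.

(** * Bounds for a projection onto the Rademacher span *)

Section rademacher_span.
Context {R : realType} {w : R -> R}.
Variables (hw : quasi_concave w) (w1 : w 1 = 1).
Local Notation mu := (@lebesgue_measure R).
Local Notation M := (morrey hw w1).
Local Notation rho := (@dyadic_rademacher R).
Let brho := @bounded_measurable_dyadic_rademacher R.

Let generators : set M :=
  [set rademacher_class hw w1 k | k in [set k | (1 <= k)%N]].

(** The functional whose values at the P F_eps are averaged over all sign
    vectors. *)
Definition signed_coef m (kappa : nat -> nat) (E : {set 'I_m}) (h : M) : R :=
  \sum_i cube_sign R E i * pairing (rho (kappa i)) h.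

Lemma cube_sign_rademacher_sqr (T : finType) (E : {set T}) i k t :
  (cube_sign R E i * rho k t) ^+ 2 = 1.
Proof.
rewrite exprMn /cube_sign -exprM mulnC exprM sqrrN !expr1n mul1r.
exact: dyadic_rademacher_sqr.
Qed.

Lemma signed_coef_linear m kappa (E : {set 'I_m}) :
  linear_for *%R (signed_coef kappa E).
Proof.
move=> k x y; rewrite /signed_coef mulr_sumr -big_split/=.
by apply: eq_bigr => i _; rewrite (pairing_linear (brho _)) mulrDr mulrCA.
Qed.

Lemma signed_coef_le m kappa (E : {set 'I_m}) (h : M) :
  `|signed_coef kappa E h| <= m%:R * `|h|.
Proof.
apply: (le_trans (ler_norm_sum _ _ _)).
apply: (@le_trans _ _ (\sum_(i < m) `|h|)); last first.
  by rewrite sumr_const card_ord mulr_natl.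
apply: ler_sum => i _; rewrite normrM /cube_sign normrX normrN1 expr1n mul1r.
rewrite -[leRHS]mul1r; apply: pairing_le => // t.
by rewrite dyadic_rademacher_norm.
Qed.

Lemma pairing_rademacher_class k j : (0 < k)%N -> (0 < j)%N ->
  pairing (rho j) (rademacher_class hw w1 k) = (j == k)%:R.
Proof.
move=> k0 j0; rewrite rademacher_classE pairing_bounded_class//.
have E t : rho k t * rho j t = rho k t * \prod_(i <- [:: j]) rho i t.
  by rewrite big_seq1.
under eq_Rintegral do rewrite E.
by rewrite walsh_rademacher_integral//= ?j0// eqseq_cons eqxx andbT.
Qed.

Lemma signed_coef_rademacher_class m kappa (E : {set 'I_m}) k :
  (forall i, (0 < kappa i)%N) -> (0 < k)%N ->
  signed_coef kappa E (rademacher_class hw w1 k) =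
  \sum_i cube_sign R E i * (kappa i == k)%:R.
Proof.
by move=> kappa0 k0; apply: eq_bigr => i _; rewrite pairing_rademacher_class.
Qed.

Let eq_on_span (L L' : M -> R) c : linear_for *%R L -> linear_for *%R L' ->
  (forall k, (0 < k)%N ->
     L (rademacher_class hw w1 k) = c * L' (rademacher_class hw w1 k)) ->
  forall h, linear_span generators h -> L h = c * L' h.
Proof.
move=> linL linL' LL'.
move=> _ [n [a [u [Gu ->]]]].
rewrite (linear_form_sum linL) (linear_form_sum linL') mulr_sumr.
by apply: eq_bigr => i _; have [k k0 <-] := Gu i; rewrite LL'//; lra.
Qed.

(** On the span, r times this functional is integration against the Riesz
    product with parameter r, a function bounded by expR 1. *)
Lemma signed_coef_riesz_bound m kappa (E : {set 'I_m}) (r : R) h :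
  (forall i, (0 < kappa i)%N) -> injective kappa ->
  0 < r -> r ^+ 2 * m%:R <= 1 ->
  rademacher_subspace hw w1 h -> `|signed_coef kappa E h| <= expR 1 / r * `|h|.
Proof.
move=> kappa0 kappaI r0 rm.
apply: (closed_linear_span_bound (signed_coef_linear kappa E)
  (signed_coef_le kappa E)).
  by rewrite divr_ge0 ?expR_ge0// ltW.
move=> {}h spanh.
pose g t := riesz r (fun i : 'I_m => cube_sign R E i * rho (kappa i) t).
have g_le t : `|g t| <= expR 1.
  apply: riesz_le; rewrite ?card_ord// => i.
  by rewrite cube_sign_rademacher_sqr.
have bg : bounded_measurable g.
  have gE : g = fun t => \sum_(A : {set 'I_m}) riesz_coef r A *
      \prod_(i in A) (cube_sign R E i * rho (kappa i) t).
    by apply/funext => t; exact: riesz_expansion.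
  rewrite gE; apply: bounded_measurable_sum => A.
  apply: bounded_measurableM; first exact: bounded_measurable_cst.
  apply: bounded_measurable_prod => i.
  by apply: bounded_measurableM; first exact: bounded_measurable_cst.
have gL : pairing g h = r * signed_coef kappa E h.
  apply: eq_on_span spanh; [exact: pairing_linear|exact: signed_coef_linear|].
  move=> k k0; rewrite signed_coef_rademacher_class// rademacher_classE.
  by rewrite pairing_bounded_class// riesz_rademacher_integral.
rewrite mulrAC ler_pdivlMr// -[X in _ * X](gtr0_norm r0) -normrM mulrC -gL.
exact: pairing_le.
Qed.

(** Each step chooses the half of the current interval on which the next
    Rademacher function has the prescribed sign. *)
Lemma dyadic_interval_signs (b : nat -> bool) n : exists q : nat,
  (q < 2 ^ n)%N /\ forall t : R, q%:R / 2 ^+ n <= t < q.+1%:R / 2 ^+ n ->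
  forall k, (0 < k <= n)%N -> rho k t = (-1) ^+ b k.
Proof.
elim: n => [|n [q [qn IH]]].
  by exists 0%N; split => // t _ k; case: k.
exists (q.*2 + b n.+1)%N; split.
  apply: (@leq_trans (q.+1).*2); last by rewrite expnS mul2n leq_double.
  by rewrite doubleS; case: (b _); rewrite ?addn1 ?addn0.
move=> t tq k /andP[k0]; rewrite leq_eqVlt => /orP[/eqP ->|kn].
  by rewrite (dyadic_rademacherE tq) -signr_odd oddD odd_double oddb.
apply: IH; last by rewrite k0.
have e : 2 ^+ n.+1 = 2 * 2 ^+ n :> R by rewrite exprS.
have p0 : 0 < 2 ^+ n :> R by rewrite exprn_gt0.
move: tq; rewrite e !ler_pdivrMr ?ltr_pdivlMr ?mulr_gt0// => /andP[h1 h2].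
have h3 : (q.*2 + b n.+1)%:R = 2 * q%:R + (b n.+1)%:R :> R.
  by rewrite natrD -muln2 natrM mulrC.
move: h1 h2; rewrite -[_.+1%:R]natr1 h3 -natr1; case: (b n.+1) => /= h1 h2;
  apply/andP; split; lra.
Qed.

(** An element h of the span is a step function. Take an interval where r_1,
    ..., r_m have the signs given by E and the later Rademacher functions are
    - 1, and another one where the later functions are 1: half the sum of the
    values of h there is the signed sum of its first m coefficients. *)
Lemma signed_coef_sup_bound m (E : {set 'I_m}) c h :
  0 < c -> (forall t, 0 < t <= 1 -> c <= w t) ->
  rademacher_subspace hw w1 h -> `|signed_coef succn E h| <= c^-1 * `|h|.
Proof.
move=> c0 cw.
apply: (closed_linear_span_bound (signed_coef_linear succn E)
  (signed_coef_le succn E)).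
  by rewrite invr_ge0 ltW.
move=> _ [n [a [u [Gu ->]]]].
have /choice[kk kkP] j :
    exists k, (0 < k)%N /\ rademacher_class hw w1 k = u j.
  by have [k k0 <-] := Gu j; exists k.
pose N := (m + \sum_j kk j)%N.
have kkN j : (kk j <= N)%N.
  by rewrite /N (bigD1 j)//= addnCA leq_addr.
pose H t := \sum_(j < n) a j * rho (kk j) t.
have bH : bounded_measurable H.
  apply: bounded_measurable_sum => j.
  by apply: bounded_measurableM; first exact: bounded_measurable_cst.
have -> : \sum_(j < n) a j *: u j = bounded_class hw w1 bH.
  rewrite -(sum_bounded_class hw w1 (fun j => brho (kk j)) bH
    (fun t => erefl)).
  by apply: eq_bigr => j _; rewrite -rademacher_classE (kkP j).2.
(* The sign of r_k, k >= 1, is that of the index k.-1 of E if k <= m, and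
   (-1) ^+ beta beyond. *)
pose b (beta : bool) k : bool :=
  oapp (fun i : 'I_m => i \in E) beta (insub k.-1).
pose v beta := \sum_(j < n) a j * (-1) ^+ b beta (kk j).
have v_le beta : `|v beta| <= c^-1 * `|bounded_class hw w1 bH|.
  have [q [qN qP]] := dyadic_interval_signs (b beta) N.
  have p0 : 0 < 2 ^+ N :> R by rewrite exprn_gt0.
  have qE : q.+1%:R / 2 ^+ N - q%:R / 2 ^+ N = 2 ^- N :> R.
    by rewrite -mulrBl -natr1 addrC addKr mul1r.
  have q0 : 0 <= q%:R / 2 ^+ N :> R by rewrite divr_ge0// ltW.
  have qq : q%:R / 2 ^+ N < q.+1%:R / 2 ^+ N :> R.
    by rewrite ltr_pM2r ?invr_gt0// ltr_nat.
  have q1 : q.+1%:R / 2 ^+ N <= 1 :> R.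
    by rewrite ler_pdivrMr// mul1r -natrX ler_nat.
  have lower := @bounded_class_lower _ _ hw w1 H bH _ _ (v beta) q0 qq q1.
  rewrite qE in lower; rewrite mulrC ler_pdivlMr// mulrC.
  apply: le_trans (lower _); last first.
    move=> t tq; apply: eq_bigr => j _; congr (_ * _).
    by apply: qP => //; rewrite (kkP j).1 kkN.
  apply: ler_wpM2r => //; apply: cw.
  by rewrite invr_gt0 p0/= invf_le1// exprn_ege1// ler1n.
have -> : signed_coef succn E (bounded_class hw w1 bH) = (v true + v false) / 2.
  rewrite /v -big_split/= mulr_suml.
  rewrite -(sum_bounded_class hw w1 (fun j => brho (kk j)) bH
    (fun t => erefl)).
  rewrite (linear_form_sum (signed_coef_linear succn E)).
  apply: eq_bigr => j _; rewrite -rademacher_classE.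
  rewrite -mulrDr -mulrA; congr (_ * _).
  have k0 := (kkP j).1.
  rewrite signed_coef_rademacher_class// /b; case: insubP => [i im iE|im]/=.
    rewrite (bigD1 i)//= iE prednK// eqxx mulr1.
    rewrite big1 ?addr0 /cube_sign => [|i' ii'].
      by lra.
    have -> : (i'.+1 == kk j) = false; last by rewrite mulr0.
    by apply/negbTE; apply: contraNneq ii' => e; rewrite -val_eqE/= iE -e.
  rewrite big1 ?expr0 ?expr1 => [|i _]; first by lra.
  have -> : (i.+1 == kk j) = false; last by rewrite mulr0.
  by apply/negbTE; apply: contraNneq im => <-; rewrite /= ltn_ord.
have h1 := v_le true; have h2 := v_le false.
rewrite normrM [`|2^-1|]ger0_norm ?invr_ge0// ler_pdivrMr//.
by apply: (le_trans (ler_normD _ _)); lra.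
Qed.

Section trace.
Variables (P : {linear M -> M}) (C : R).
Hypotheses (C0 : 0 <= C) (PC : forall x, `|P x| <= C * `|x|).
Hypothesis Pidem : forall x, P (P x) = P x.
Hypothesis Prange : range P = rademacher_subspace hw w1.

Let P_rademacher_class k : (0 < k)%N ->
  P (rademacher_class hw w1 k) = rademacher_class hw w1 k.
Proof.
move=> k0; have : range P (rademacher_class hw w1 k).
  rewrite Prange; apply: subset_closure.
  exists 1%N, (fun=> 1), (fun=> rademacher_class hw w1 k); split.
    by move=> _; exists k.
  by rewrite big_ord1 scale1r.
by case=> y _ <-; rewrite Pidem.
Qed.

Let P_in x : rademacher_subspace hw w1 (P x).
Proof. by rewrite -Prange; exists x. Qed.

(** The inequality of projection_trace_bound for Walsh polynomials in the
    functions rho (kappa i); E is the set of indices where the sign vector is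
    - 1. *)
Lemma projection_multilinear_bound m (kappa : nat -> nat) (a : {set 'I_m} -> R)
    (F : {set 'I_m} -> R -> R) (B K : R) :
  (forall i, (0 < kappa i)%N) -> 0 <= B ->
  (forall (E : {set 'I_m}) h, rademacher_subspace hw w1 h ->
     `|signed_coef kappa E h| <= B * `|h|) ->
  (forall E t, F E t = \sum_(A : {set 'I_m}) a A *
     \prod_(i in A) (cube_sign R E i * rho (kappa i) t)) ->
  (forall E, bounded_measurable (F E) -> (morrey_norm w (F E) <= K%:E)%E) ->
  \sum_i a [set i]%SET <= B * (C * K).
Proof.
move=> kappa0 B0 LB FE FK.
have bW (A : {set 'I_m}) :
    bounded_measurable (fun t => \prod_(i in A) rho (kappa i) t).
  by apply: bounded_measurable_prod => i.
have bF E : bounded_measurable (F E).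
  have -> : F E = fun t => \sum_(A : {set 'I_m}) a A *
      \prod_(i in A) (cube_sign R E i * rho (kappa i) t) by apply/funext => t.
  apply: bounded_measurable_sum => A.
  apply: bounded_measurableM; first exact: bounded_measurable_cst.
  apply: bounded_measurable_prod => i.
  by apply: bounded_measurableM; first exact: bounded_measurable_cst.
apply: (@projection_trace_bound _ _ _ P C K B
  (fun i : 'I_m => pairing (rho (kappa i)))
  (fun A => bounded_class hw w1 (bW A))) => //.
- by move=> i; exact: pairing_linear.
- move=> i.
  have -> : bounded_class hw w1 (bW [set i]%SET) =
      rademacher_class hw w1 (kappa i).
    rewrite rademacher_classE; congr morrey_class; apply: val_inj => /=.
    by apply/funext => t; rewrite big_set1.
  by rewrite P_rademacher_class// pairing_rademacher_class// eqxx.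
- move=> E x; apply: le_trans (LB E _ (@P_in x)); exact: ler_norm.
- move=> E; rewrite (sum_bounded_class hw w1 bW (bF E)).
    by rewrite -lee_fin bounded_class_norm FK.
  move=> t; rewrite FE; apply: eq_bigr => A _.
  by rewrite big_split/= mulrA.
Qed.

(** The functions F_eps are the bounded Riesz products with parameter 1 / n.
    *)
Lemma projection_bound_of_weight_ge c n : (0 < n)%N -> 0 < c ->
  (forall t, 0 < t <= 1 -> c <= w t) -> n%:R <= c^-1 * (C * expR 1).
Proof.
move=> n0 c0 cw; have n0' : n%:R != 0 :> R by rewrite pnatr_eq0 -lt0n.
pose r : R := n%:R^-1.
pose F (E : {set 'I_(n ^ 2)}) t :=
  riesz r (fun i => cube_sign R E i * rho i.+1 t).
have := @projection_multilinear_bound (n ^ 2) succn (riesz_coef r) F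
  c^-1 (expR 1).
rewrite (eq_bigr (fun=> r)) => [|i _]; last exact: riesz_coef1.
rewrite sumr_const card_ord -[r *+ _]mulr_natl natrX expr2 /r mulfK//.
apply => //.
- by rewrite invr_ge0 ltW.
- by move=> E h; exact: signed_coef_sup_bound.
- by move=> E t; exact: riesz_expansion.
move=> E bF; apply: (bounded_morrey_norm_le hw w1) => // t.
apply: riesz_le => [|i]; first by rewrite card_ord natrX -exprMn mulVf// expr1n.
by rewrite cube_sign_rademacher_sqr.
Qed.

(** The functions F_eps are the positive Riesz products over n ^ 2 sparse
    scales. *)
Lemma projection_bound_of_weight_vanish (kappa : nat -> nat) n : (0 < n)%N ->
  {homo kappa : i j / (i < j)%N} -> (0 < kappa 0)%N ->
  (forall i, w (2 ^- kappa i) <= 2 ^- i.+1) ->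
  n%:R <= expR 1 * (C * 3).
Proof.
move=> n0 kappaI kappa0 wk; have n0' : 0 < n%:R :> R by rewrite ltr0n.
have kappa_gt0 i : (0 < kappa i)%N.
  by case: i => // i; apply: (ltn_trans kappa0); exact: kappaI.
have kappa_inj : injective kappa.
  by move=> i j ij; case: (ltngtP i j) => // /kappaI; rewrite ij ltnn.
pose m := (n ^ 2)%N.
pose F (E : {set 'I_m}) t := \prod_i (1 + cube_sign R E i * rho (kappa i) t).
(* 1 / n is the parameter of the Riesz product used in the dual estimate *)
have := @projection_multilinear_bound m kappa (fun=> 1) F (expR 1 / n%:R^-1) 3.
rewrite sumr_const card_ord natrX expr2 invrK mulrAC.
rewrite ler_pM2r//; apply => //.
- move=> E h; rewrite -[n%:R in leRHS]invrK.
  apply: signed_coef_riesz_bound => //.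
    by rewrite invr_gt0.
  by rewrite natrX -exprMn mulVf ?gt_eqF// expr1n.
- by move=> E t; rewrite /F prodr1D; apply: eq_bigr => A _; rewrite mul1r.
move=> E bF; apply: morrey_norm_le => // a b a0 ab b1.
pose sigma (i : nat) : R := oapp (cube_sign R E) 1 (insub i).
have sigma1 i : `|sigma i| = 1.
  rewrite /sigma; case: insub => [j|] /=; last by rewrite normr1.
  by rewrite /cube_sign normrX normrN1 expr1n.
have FE t : F E t = \prod_(0 <= i < m) (1 + sigma i * rho (kappa i) t).
  by rewrite big_mkord; apply: eq_bigr => i _; rewrite /sigma valK.
have F0 t : 0 <= F E t.
  apply: prodr_ge0 => i _.
  have := ler_norm (- (cube_sign R E i * rho (kappa i) t)).
  rewrite normrN normrM dyadic_rademacher_norm /cube_sign normrX normrN1 expr1n.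
  by rewrite mulr1; lra.
have ba0 : 0 < b - a by rewrite subr_gt0.
(* p counts the scales 2 ^- kappa i that exceed the length of the interval *)
have exp_ : exists p, (p == m) || (2 ^- kappa p <= b - a).
  by exists m; rewrite eqxx.
case: (ex_minnP exp_) => p pP pmin.
have pm : (p <= m)%N by apply: pmin; rewrite eqxx.
have := @sparse_product_integral_le R kappa sigma m p a b kappaI kappa0 sigma1
  pm (ltW ab).
have -> : (p < m)%N ==> (2 ^- kappa p <= b - a).
  apply/implyP => p_lt_m; move: pP; rewrite orb_idl// => /eqP pE.
  by rewrite pE ltnn in p_lt_m.
move=> /(_ isT); under eq_Rintegral do rewrite -FE.
move=> int_le.
under eq_Rintegral do rewrite (ger0_norm (F0 _)).
have wp : w (b - a) * 2 ^+ p <= 1.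
  case: p pP pmin pm int_le => [|p] pP pmin pm _.
    by rewrite mulr1 -w1; apply: (quasi_concave_nondecreasing hw); lra.
  rewrite -ler_pdivlMr ?exprn_gt0// mul1r; apply: le_trans (wk p).
  have : ~~ ((p == m) || (2 ^- kappa p <= b - a)).
    by apply/negP => /pmin; rewrite ltnn.
  rewrite negb_or -ltNge => /andP[_ lt_p].
  apply: (quasi_concave_nondecreasing hw); [lra|exact: ltW|].
  by rewrite invf_le1 ?exprn_gt0// exprn_ege1// ler1n.
rewrite mulrAC ler_pdivrMr//.
have wba0 : 0 <= w (b - a) by apply: (quasi_concave_ge0 hw); lra.
apply: (le_trans (ler_wpM2l wba0 int_le)).
have l3 : 0 <= 3 * (b - a) by lra.
have := ler_wpM2r l3 wp; lra.
Qed.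

End trace.

End rademacher_span.

Theorem theorem3 (R : realType) (w : R -> R)
    (hw : quasi_concave w) (w1 : w 1 = 1) :
  ~ complemented (rademacher_subspace hw w1).
Proof.
move=> [P [[C0 PC0] Pidem Prange]].
pose C := `|C0|.
have C_ge0 : 0 <= C by exact: normr_ge0.
have PC x : `|P x| <= C * `|x|.
  by apply: (le_trans (PC0 x)); apply: ler_wpM2r => //; exact: ler_norm.
suff [B nB] : exists B : R, forall n, (0 < n)%N -> n%:R <= B.
  have := nB (Num.truncn B).+1 isT.
  by rewrite leNgt truncnS_gt.
have [[c [c0 cw]]|wN] :=
    pselect (exists c, 0 < c /\ forall t, 0 < t <= 1 -> c <= w t).
  exists (c^-1 * (C * expR 1)) => n n0.
  exact: (projection_bound_of_weight_ge C_ge0 PC Pidem Prange).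
exists (expR 1 * (C * 3)) => n n0.
have small i : exists K : nat, forall k, (K <= k)%N -> w (2 ^- k) <= 2 ^- i.+1.
  have [t /andP[t0 t1] wt] : exists2 t, 0 < t <= 1 & w t < 2 ^- i.+1.
    apply: contrapT => H; apply: wN; exists (2 ^- i.+1).
    split; first by rewrite invr_gt0 exprn_gt0.
    by move=> t t01; rewrite leNgt; apply/negP => wt; apply: H; exists t.
  pose K := (Num.truncn t^-1).+1; exists K => k Kk.
  apply: le_trans (ltW wt); apply: (quasi_concave_nondecreasing hw) => //.
  rewrite -[leRHS]invrK lef_pV2 ?posrE ?exprn_gt0 ?invr_gt0//.
  apply: (@le_trans _ _ K%:R); first by rewrite ltW// truncnS_gt.
  by rewrite -natrX ler_nat (leq_trans Kk)// ltnW// ltn_expl.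
have [K KP] := choice small.
(* the partial sums are strictly increasing, and kappa i >= K i *)
pose kappa i := (\sum_(0 <= j < i.+1) (K j).+1)%N.
apply: (projection_bound_of_weight_vanish C_ge0 PC Pidem Prange
  (kappa := kappa)) => //.
- apply: homo_ltn => [i j k|i]; first exact: ltn_trans.
  by rewrite /kappa [X in (_ < X)%N]big_nat_recr//= -addSnnS leq_addr.
- by rewrite /kappa big_nat1.
- by move=> i; apply: KP; rewrite /kappa big_nat_recr//= addnS leqW// leq_addl.
Qed.
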